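(* Let $F:\mathbf{Comp}\to\mathbf{Comp}$ be a preimage preserving mecw-functor with $F1\ne F2$. A compact Hausdorff space $X$ is skeletally generated if and only if the space $FX$ is skeletally generated.
   Context: All spaces are Hausdorff and all maps are continuous. $\mathbf{Comp}$ is the category of compact Hausdorff spaces (compacta) and continuous maps. A map $f:X\to Y$ between topological spaces is skeletal if for each nowhere dense subset $A\subset Y$ the preimage $f^{-1}(A)$ is nowhere dense in $X$. An inverse spectrum $\mathcal S=\{X_\alpha,p_\alpha^\beta,\Sigma\}$ over a directed partially ordered set $\Sigma$ is an $\omega$-spectrum if: each $X_\alpha$ has countable weight; $\Sigma$ is $\omega$-complete, i.e. each countable subset of $\Sigma$ has a smallest upper bound in $\Sigma$; and $\mathcal S$ is $\omega$-continuous, i.e. for any countable directed subset $\Sigma'\subset\Sigma$ with $\gamma=\sup\Sigma'$ the limit map $\lim p_\alpha^\gamma:X_\gamma\to\lim\{X_\alpha,p_\alpha^\beta,\Sigma'\}$ is a homeomorphism. A compact Hausdorff space $X$ is skeletally generated if it is homeomorphic to the limit of an inverse (continuous) $\omega$-spectrum $\{X_\alpha,\pi_\alpha^\beta,\Sigma\}$ consisting of metrizable compacta and surjective skeletal bonding projections $\pi_\alpha^\beta:X_\beta\to X_\alpha$. A functor $F:\mathbf{Comp}\to\mathbf{Comp}$ is: monomorphic (resp. epimorphic) if $Ff$ is injective (resp. surjective) for every injective (resp. surjective) map $f$ between compacta; continuous if it preserves limits of inverse spectra of compacta, i.e. for each inverse spectrum $\mathcal S$ of compacta over a directed set the natural map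 $F(\lim\mathcal S)\to\lim F\mathcal S$ is a homeomorphism; weight-preserving if $w(FX)\le w(X)$ for each infinite compactum $X$, where $w$ denotes the weight. A mecw-functor is a monomorphic, epimorphic, continuous, weight-preserving functor. For a monomorphic functor $F$ and a closed subspace $A$ of a compactum $X$, $FA$ is identified with the subspace $Fi(FA)\subset FX$, where $i:A\to X$ is the inclusion. A commutative square of continuous maps between compacta, with maps $\tilde f:\tilde X\to\tilde Y$, $p_X:\tilde X\to X$, $p_Y:\tilde Y\to Y$, $f:X\to Y$ and $p_Y\circ\tilde f=f\circ p_X$, is bicommutative if $\tilde f(p_X^{-1}(x))=p_Y^{-1}(f(x))$ for all $x\in X$. $F$ preserves preimages if it preserves the bicommutativity of such squares with $f,\tilde f$ injective. (For monomorphic $F$: $(Ff)^{-1}(FZ)=F(f^{-1}(Z))$ for every map $f:X\to Y$ between compacta and every closed $Z\subset Y$.) A natural number $n$ is identified with the discrete space $\{0,\dots,n-1\}$; $F1\neq F2$ means that $F1$, viewed as a subspace of $F2$ via the inclusion $1=\{0\}\subset 2=\{0,1\}$, is not all of $F2$. *)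

(* Defs.v *)
From HB Require Import structures.
From mathcomp Require Import all_boot all_order all_algebra.
From mathcomp Require Import all_classical all_reals all_analysis.

Set Implicit Arguments.
Unset Strict Implicit.
Unset Printing Implicit Defensive.

Import Order.TTheory.
Local Open Scope classical_set_scope.
Local Open Scope card_scope.
Local Open Scope order_scope.

(* The underlying type is not required to be pointed: the empty space is a
   compactum. *)
HB.mixin Record Topological_isCompactum T & Topological T := {
  compactumT : compact [set: T];
  compactum_hausdorff : hausdorff_space T
}.

#[short(type="compactumType")]
HB.structure Definition Compactum :=
  {T of Topological T & Topological_isCompactum T}.

Definition surjective_map (X Y : Type) (f : X -> Y) := range f = [set: Y].

Definition homeomorphism (X Y : topologicalType) (f : X -> Y) :=
  continuous f /\ exists g : Y -> X, [/\ continuous g, cancel f g & cancel g f].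

Definition homeomorphic (X Y : topologicalType) :=
  exists f : X -> Y, homeomorphism f.

Definition metrizable (R : realType) (X : topologicalType) :=
  exists M : metricType R, homeomorphic X M.

(* w(Y) <= w(X).  The weight is the least cardinality of a basis; cardinals are
   available only through the comparison [#<=], so the inequality between the
   two minima is written out. *)
Definition weight_le (Y X : topologicalType) :=
  forall B : set (set X), basis B ->
    exists2 C : set (set Y), basis C & C #<= B.

Definition nowhere_dense (X : topologicalType) (A : set X) :=
  interior (closure A) = set0.

Definition skeletal (X Y : topologicalType) (f : X -> Y) :=
  forall A : set Y, nowhere_dense A -> nowhere_dense (f @^-1` A).

HB.instance Definition _ (T : Type) (A : set T) :=
  SubType.copy (set_type A) {x : T | x \in A}.
HB.instance Definition _ d (T : porderType d) (A : set T) :=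
  Order.SubChoice_isSubPOrder.Build d T (mem A) d (set_type A).

Definition directed_set d (Sigma : porderType d) (A : set Sigma) :=
  A !=set0 /\
  forall a b, A a -> A b -> exists2 c, A c & (a <= c) && (b <= c).

(* The empty subset is countable, so Sigma has a least element; [directed_set]
   requires nonemptiness, as usual for directed sets. *)
Definition omega_complete d (Sigma : porderType d) :=
  forall A : set Sigma, countable A -> exists g, isLub A g.

Record inverse_spectrum d (Sigma : porderType d) := InverseSpectrum {
  spectrum_obj :> Sigma -> compactumType;
  bonding : forall a b : Sigma, a <= b ->
    continuousType (spectrum_obj b) (spectrum_obj a);
  bonding_id : forall a (aa : a <= a) x, bonding aa x = x;
  bonding_comp : forall a b c (ab : a <= b) (bc : b <= c) (ac : a <= c) x,
    bonding ab (bonding bc x) = bonding ac x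
}.

Section limit.
Context d (Sigma : porderType d) (S : inverse_spectrum Sigma).

Local Notation prodS := (prod_topology (fun a => S a)).

Definition threads : set prodS :=
  [set x | forall a b (ab : a <= b), bonding S ab (x b) = x a].

Definition spectrum_lim : Type := set_type threads.

HB.instance Definition _ := Topological.copy spectrum_lim (set_type threads).

Definition lim_proj (a : Sigma) (x : spectrum_lim) : S a := \val x a.

Lemma lim_proj_continuous a : continuous (lim_proj a).
Proof.
move=> x; apply: (@continuous_comp spectrum_lim prodS
  (S a) val (fun y => y a)).
  exact: initial_continuous.
exact: (@proj_continuous _ (fun a => S a) a).
Qed.

HB.instance Definition _ a :=
  @isContinuous.Build spectrum_lim (S a) (lim_proj a) (@lim_proj_continuous a).

Lemma lim_proj_bonding a b (ab : a <= b) x :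
  bonding S ab (lim_proj b x) = lim_proj a x.
Proof. exact: (set_mem (valP x)). Qed.

Lemma threads_closed : closed threads.
Proof.
move=> x clx a b ab; apply: (@compactum_hausdorff (S a)) => U V nU nV.
have cb : {for x, continuous (fun y : prodS => bonding S ab (y b))}.
  apply: (@continuous_comp _ (S b) _ (fun y : prodS => y b)).
    exact: (@proj_continuous _ (fun a => S a) b).
  exact: cts_fun.
have nU' : nbhs x [set y : prodS | U (bonding S ab (y b))] by exact: cb nU.
have nV' : nbhs x [set y : prodS | V (y a)].
  exact: (@proj_continuous _ (fun a => S a) a x _ nV).
have [y [/= yT [Uy Vy]]] := clx _ (filterI nU' nV').
by exists (y a); split => //; rewrite -(yT a b ab).
Qed.

Lemma spectrum_lim_compact : compact [set: spectrum_lim].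
Proof.
have cT : compact threads.
  apply: (@subclosed_compact _ threads
    [set x : prodS | forall a, [set: S a] (x a)]) => //.
    exact: threads_closed.
  by apply: (@tychonoff Sigma (fun a => S a) (fun a => [set: S a])) => a;
    exact: compactumT.
move=> F PF _; have [|p [pT pF]] := cT ((val : spectrum_lim -> _) @ F) _.
  by apply: (@filterS _ F _ setT) filterT => x _; exact: (set_mem (valP x)).
exists (exist _ p (mem_set pT)); split=> // A B FA [_ [[W oW <-] /= Wp WB]].
have [||q [[y Ay <-] Wq]] := pF ((val : spectrum_lim -> prodS) @` A) W.
- by apply: (@filterS _ F _ A) FA => y Ay; exists y.
- exact: open_nbhs_nbhs.
- by exists y; split => //; exact: WB.
Qed.

Lemma spectrum_lim_hausdorff : hausdorff_space spectrum_lim.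
Proof.
move=> p q pq; apply: val_inj.
have hP : hausdorff_space prodS.
  by apply: hausdorff_product => a; exact: compactum_hausdorff.
apply: hP => U V nU nV.
have cv : continuous (val : spectrum_lim -> prodS).
  exact: initial_continuous.
have [x [Ux Vx]] := pq _ _ (cv p _ nU) (cv q _ nV).
by exists (val x).
Qed.

HB.instance Definition _ := Topological_isCompactum.Build spectrum_lim
  spectrum_lim_compact spectrum_lim_hausdorff.

Definition lim_induced (Z : Type) (f : forall a, Z -> S a)
    (f_bonding : forall a b (ab : a <= b) z, bonding S ab (f b z) = f a z)
    (z : Z) : spectrum_lim :=
  exist _ (fun a => f a z)
    (mem_set ((fun a b ab => f_bonding a b ab z) : threads (fun a => f a z))).

End limit.

Section restriction.
Context d (Sigma : porderType d) (S : inverse_spectrum Sigma).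

Definition restrict_spectrum (A : set Sigma) : inverse_spectrum (set_type A) :=
  @InverseSpectrum d (set_type A) (fun a => S (\val a))
    (fun a b (ab : a <= b) => bonding S (ab : \val a <= \val b))
    (fun a aa x => bonding_id _ x)
    (fun a b c ab bc ac x => bonding_comp _ _ _ x).

Lemma ubound_val (A : set Sigma) g (ub : ubound A g) (a : set_type A) :
  \val a <= g.
Proof. by apply: ub; exact: (set_mem (valP a)). Qed.

Definition limit_map (A : set Sigma) g (ub : ubound A g) :
    S g -> spectrum_lim (restrict_spectrum A) :=
  @lim_induced _ _ (restrict_spectrum A) (S g)
    (fun a => bonding S (ubound_val ub a))
    (fun a b ab x => bonding_comp _ _ _ x).

Definition omega_continuous :=
  forall (A : set Sigma) g (lub : isLub A g),
    countable A -> directed_set A -> homeomorphism (limit_map lub.1).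

Definition omega_spectrum :=
  [/\ forall a, @second_countable (S a),
      omega_complete Sigma
    & omega_continuous].

End restriction.

Definition skeletally_generated (R : realType) (X : compactumType) :=
  exists d (Sigma : porderType d) (S : inverse_spectrum Sigma),
    [/\ directed_set [set: Sigma],
        omega_spectrum S,
        forall a, metrizable R (S a),
        forall a b (ab : a <= b),
          surjective_map (bonding S ab) /\ skeletal (bonding S ab)
      & homeomorphic X (spectrum_lim S)].

Record comp_functor := CompFunctor {
  functor_obj :> compactumType -> compactumType;
  fmap : forall X Y : compactumType,
    continuousType X Y -> continuousType (functor_obj X) (functor_obj Y);
  fmap_id : forall (X : compactumType) x,
    fmap (idfun : continuousType X X) x = x;
  fmap_comp : forall (X Y Z : compactumType)
    (g : continuousType Y Z) (f : continuousType X Y) x,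
    fmap (g \o f : continuousType X Z) x = fmap g (fmap f x)
}.

Section functor_properties.
Variable F : comp_functor.

Definition monomorphic := forall (X Y : compactumType) (f : continuousType X Y),
  injective f -> injective (fmap F f).

Definition epimorphic := forall (X Y : compactumType) (f : continuousType X Y),
  surjective_map f -> surjective_map (fmap F f).

Section image_spectrum.
Context d (Sigma : porderType d) (S : inverse_spectrum Sigma).

Lemma fmap_bonding_id a (aa : a <= a) x : fmap F (bonding S aa) x = x.
Proof.
have -> : bonding S aa = (idfun : continuousType (S a) (S a)).
  by apply/continuousEP => y; exact: bonding_id.
exact: fmap_id.
Qed.

Lemma fmap_bonding_comp a b c (ab : a <= b) (bc : b <= c) (ac : a <= c) x :
  fmap F (bonding S ab) (fmap F (bonding S bc) x) = fmap F (bonding S ac) x.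
Proof.
rewrite -fmap_comp; congr (fmap F _ x).
by apply/continuousEP => y; exact: bonding_comp.
Qed.

Definition map_spectrum : inverse_spectrum Sigma :=
  @InverseSpectrum d Sigma (fun a => F (S a))
    (fun a b ab => fmap F (bonding S ab)) fmap_bonding_id fmap_bonding_comp.

Lemma fmap_lim_proj a b (ab : a <= b) x :
  fmap F (bonding S ab) (fmap F (lim_proj (S := S) b) x) =
  fmap F (lim_proj (S := S) a) x.
Proof.
rewrite -fmap_comp; congr (fmap F _ x).
by apply/continuousEP => y; exact: lim_proj_bonding.
Qed.

Definition lim_comparison : F (spectrum_lim S) -> spectrum_lim map_spectrum :=
  @lim_induced _ _ map_spectrum (F (spectrum_lim S))
    (fun a => fmap F (lim_proj (S := S) a)) fmap_lim_proj.

End image_spectrum.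

Definition functor_continuous :=
  forall d (Sigma : porderType d) (S : inverse_spectrum Sigma),
    directed_set [set: Sigma] -> homeomorphism (lim_comparison (S := S)).

Definition weight_preserving :=
  forall X : compactumType, infinite_set [set: X] -> weight_le (F X) X.

Definition mecw_functor :=
  [/\ monomorphic, epimorphic, functor_continuous & weight_preserving].

End functor_properties.

(* The square with sides [ft : Xt -> Yt], [pX : Xt -> X], [pY : Yt -> Y] and
   [f : X -> Y]; commutativity is part of the definition. *)
Definition bicommutative (Xt Yt X Y : Type)
    (ft : Xt -> Yt) (pX : Xt -> X) (pY : Yt -> Y) (f : X -> Y) :=
  (forall x, pY (ft x) = f (pX x)) /\
  forall x : X, ft @` (pX @^-1` [set x]) = pY @^-1` [set f x].

Definition preserves_preimages (F : comp_functor) :=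
  forall (Xt Yt X Y : compactumType)
    (ft : continuousType Xt Yt) (pX : continuousType Xt X)
    (pY : continuousType Yt Y) (f : continuousType X Y),
    injective f -> injective ft -> bicommutative ft pX pY f ->
    bicommutative (fmap F ft) (fmap F pX) (fmap F pY) (fmap F f).

Definition finite_space (n : nat) : Type := discrete_topology 'I_n.

HB.instance Definition _ n :=
  Topological.copy (finite_space n) (discrete_topology 'I_n).

Lemma finite_space_compact n : compact [set: finite_space n].
Proof. by apply: finite_compact; exact: (@finite_finset 'I_n). Qed.

Lemma finite_space_hausdorff n : hausdorff_space (finite_space n).
Proof. exact: (@discrete_hausdorff (discrete_topology 'I_n)). Qed.

HB.instance Definition _ n := Topological_isCompactum.Build (finite_space n)
  (@finite_space_compact n) (@finite_space_hausdorff n).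

Definition incl12 : finite_space 1 -> finite_space 2 :=
  widen_ord (leqnSn 1).

Lemma incl12_continuous : continuous incl12.
Proof.
move=> x A /nbhs_singleton Ax.
by apply/(@principal_filterP (discrete_topology 'I_1)).
Qed.

HB.instance Definition _ := isContinuous.Build _ _ incl12 incl12_continuous.

Definition F1_neq_F2 (F : comp_functor) :=
  range (fmap F incl12) <> [set: F (finite_space 2)].

(* Main.v *)
(* Proof idea.  Take a family of maps f_j from X to second countable spaces that
   separates points, and for countable E let q_E : X -> X_E be the quotient
   that identifies points not separated by the f_j with j in E.  X is
   skeletally generated iff q_E is skeletal for all countable E closed under
   suitable countable-valued operations; such E form an omega-complete index
   set over which X is the limit of the X_E, and F X the limit of the F X_E.

   F need not preserve skeletal maps, but F p is skeletal when p : X -> Y is a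
   skeletal surjection of metrizable compacta whose fibres over isolated points
   are singletons, and closing E under one more operation gives q_E this
   property.  Indeed, a nonempty open subset of F X contains an element with
   finite support (X is an image of the Cantor set), and the hypothesis on p
   allows disjoint neighbourhoods of the points of that support to be matched
   with distinct points of Y; preservation of preimages and a compactness
   argument then produce an open subset of the image.

   Conversely, if F1 <> F2 and F p is skeletal, so is p: if p mapped a closed
   set K with nonempty interior onto a nowhere dense set, the open set of those
   elements of F X that are not supported off the interior of K would be
   nonempty, while any element of F Y can be approximated by elements with
   finite support off p(K). *)

From HB Require Import structures.
From mathcomp Require Import all_boot all_order all_algebra finmap lra generic_quotient.
From mathcomp Require Import all_classical all_reals all_analysis.
Require Import Defs.

Set Implicit Arguments.
Unset Strict Implicit.
Unset Printing Implicit Defensive.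

Import Order.TTheory numFieldNormedType.Exports.
Local Open Scope order_scope.
Local Open Scope card_scope.
Local Open Scope classical_set_scope.

(** * Compacta *)

Section compacta.
Implicit Types X Y Z : compactumType.

Lemma surjective_mapP (S T : Type) (f : S -> T) :
  surjective_map f <-> forall y, exists x, f x = y.
Proof.
split=> [sf y|sf]; first by have : [set: T] y by []; rewrite -sf => -[x _ <-]; exists x.
by apply/seteqP; split=> // y _; have [x <-] := sf y; exists x.
Qed.

Lemma closed_compact X (A : set X) : closed A -> compact A.
Proof. by move=> cA; apply: (subclosed_compact cA (@compactumT X)). Qed.

Lemma continuous_image_closed_hausdorff X (T : topologicalType) (f : X -> T) A :
  hausdorff_space T -> continuous f -> closed A -> closed (f @` A).
Proof.
move=> hT cf cA; apply: compact_closed => //.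
by apply: continuous_compact; [exact: continuous_subspaceT|exact: closed_compact].
Qed.

Lemma continuous_image_closed X Y (f : X -> Y) A :
  continuous f -> closed A -> closed (f @` A).
Proof. exact/continuous_image_closed_hausdorff/compactum_hausdorff. Qed.

Lemma continuous_preimage_closed (S T : topologicalType) (f : S -> T) A :
  continuous f -> closed A -> closed (f @^-1` A).
Proof. by move=> /continuous_closedP; exact. Qed.

Lemma continuous_preimage_open (S T : topologicalType) (f : S -> T) A :
  continuous f -> open A -> open (f @^-1` A).
Proof. by move=> /continuousP; exact. Qed.

Lemma closed_singleton X (x : X) : closed [set x].
Proof.
exact/accessible_closed_set1/hausdorff_accessible/compactum_hausdorff.
Qed.

(** The form of compactness used throughout: a cluster point of the filter generated by the [D i]
    lies in each of them, since they are closed. *)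
Lemma directed_closed_nonempty X (I : Type) (D : I -> set X) :
  (exists i : I, True) ->
  (forall i j, exists k, D k `<=` D i `&` D j) ->
  (forall i, closed (D i)) -> (forall i, D i !=set0) ->
  exists x, forall i, D i x.
Proof.
move=> [i0 _] dirD clD D0.
have FF : ProperFilter (filter_from [set: I] D).
  apply: filter_from_proper => [|i _]; last exact: D0.
  apply: filter_from_filter; first by exists i0.
  by move=> i j _ _; have [k Dk] := dirD i j; exists k.
have [|x [_ clx]] := @compactumT X _ FF; first by exists i0.
exists x => i; apply: clD => U nU.
by apply: clx nU; exists i.
Qed.

Lemma continuous_bijective_homeomorphism_hausdorff X (T : topologicalType)
    (f : X -> T) :
  hausdorff_space T -> continuous f -> injective f -> surjective_map f ->
  homeomorphism f.
Proof.
move=> hT cf inj sf; split=> //.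
have [g gK] := choice ((surjective_mapP f).1 sf).
have fK : cancel f g by move=> x; apply: inj.
exists g; split=> //; apply/continuous_closedP => A cA.
rewrite [_ @^-1` _](_ : _ = f @` A).
  exact: continuous_image_closed_hausdorff.
apply/seteqP; split=> [y Ay|_ [x Ax <-]]; first by exists (g y).
by rewrite /preimage /= fK.
Qed.

Lemma continuous_bijective_homeomorphism X Y (f : X -> Y) :
  continuous f -> injective f -> surjective_map f -> homeomorphism f.
Proof.
exact/continuous_bijective_homeomorphism_hausdorff/compactum_hausdorff.
Qed.

(** A continuous surjection between compacta is closed, hence a quotient map. *)
Lemma quotient_factor X Y (Z : topologicalType) (q : X -> Y) (g : X -> Z) :
  continuous q -> surjective_map q -> continuous g ->
  (forall x y, q x = q y -> g x = g y) ->
  exists h : continuousType Y Z, forall x, h (q x) = g x.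
Proof.
move=> cq sq cg ker.
have [s sK] := choice ((surjective_mapP q).1 sq).
(* The section [s] need not be continuous; still, the preimage of [A] under [g \o s] is the
   [q]-image of its preimage under [g]. *)
have ch : continuous (g \o s).
  apply/continuous_closedP => A cA.
  rewrite [_ @^-1` _](_ : _ = q @` (g @^-1` A)).
    by apply: continuous_image_closed => //; exact: continuous_preimage_closed.
  apply/seteqP; split=> [y Ay|_ [x Ax <-]]; first by exists (s y).
  by rewrite /preimage /= (ker _ x) ?sK.
by exists (mkcts ch) => x /=; apply: ker; rewrite sK.
Qed.

Lemma closed_nbhs X (x : X) (U : set X) : nbhs x U ->
  exists2 K, closed K & nbhs x K /\ K `<=` U.
Proof.
move=> nU.
have reg := compact_regular (@compactum_hausdorff X) (@compactumT X)
  (@filterT _ (nbhs x) _).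
have [V nV VU] := reg _ U nU.
exists (closure V); first exact: closed_closure.
by split=> //; apply: filterS nV; exact: subset_closure.
Qed.

Lemma hausdorff_separated (T : topologicalType) (x y : T) :
  hausdorff_space T -> x <> y ->
  exists U V : set T, [/\ nbhs x U, nbhs y V & U `&` V = set0].
Proof.
move=> hT xy; apply: contrapT => H; apply: xy; apply: hT.
move=> U V nU nV; apply: contrapT => /nonemptyPn UV0.
by apply: H; exists U, V.
Qed.

Lemma separated_nbhs (T : choiceType) X (s : seq T) (y : T -> X)
    (V : T -> set X) :
  {in s &, injective y} -> {in s, forall t, nbhs (y t) (V t)} ->
  exists W : T -> set X,
    {in s, forall t, [/\ closed (W t), nbhs (y t) (W t) & W t `<=` V t]} /\
    {in s &, forall t u, t <> u -> W t `&` W u = set0}.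
Proof.
move=> inj nV.
have H (tu : T * T) : exists UV : set X * set X,
    tu.1 \in s -> tu.2 \in s -> tu.1 <> tu.2 ->
    [/\ nbhs (y tu.1) UV.1, nbhs (y tu.2) UV.2 & UV.1 `&` UV.2 = set0].
  case: tu => t u /=.
  have [[ts us tu]|n] := pselect [/\ t \in s, u \in s & t <> u].
    have [|U [V' UV]] := hausdorff_separated (@compactum_hausdorff X) (_ : y t <> y u).
      by move/inj; tauto.
    by exists (U, V').
  by exists (set0, set0) => ts us tu; case: n.
have [G' GP'] := choice H; pose G t u := G' (t, u).
have GP t u : t \in s -> u \in s -> t <> u ->
  [/\ nbhs (y t) (G t u).1, nbhs (y u) (G t u).2 & (G t u).1 `&` (G t u).2 = set0].
  exact: GP' (t, u).
(* The separation chosen for [(t, u)] is unrelated to that for [(u, t)], so [N t] takes the first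
   half of the one and the second half of the other. *)
pose N t := V t `&` \bigcap_(u in [set` [fset u in s]%fset])
   (if u == t then setT else (G t u).1 `&` (G u t).2).
have nN t : t \in s -> nbhs (y t) (N t).
  move=> ts; apply: filterI; first exact: nV.
  apply: filter_bigI => u; rewrite !inE /= => us.
  case: eqP => ut; first exact: filterT.
  have [|? _ _] := GP t u ts us; first by move=> tu; exact: ut.
  have [|_ ? _] := GP u t us ts; first by move=> tu; exact: ut.
  exact: filterI.
have {}nN t : exists K, t \in s -> [/\ closed K, nbhs (y t) K & K `<=` N t].
  have [/nN/closed_nbhs[K cK [nK KN]]|] := boolP (t \in s); first by exists K.
  by exists set0.
have [W WP] := choice nN.
exists W; split=> [t ts|t u ts us tu].
  by have [? ? WN] := WP t ts; split=> // z /WN[].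
apply/seteqP; split=> // z [Wt Wu].
have [_ _ WN] := WP t ts; have [_ _ WN'] := WP u us.
have [_ /(_ t)] := WN' z Wu; have [_ /(_ u)] := WN z Wt.
rewrite /= !inE => /(_ us) + /(_ ts).
case: eqP => [/esym/tu //|_]; case: eqP => [/tu //|_] [zt _] [_ zu].
have [//| _ _ GP0] := GP t u ts us.
by suff : ((G t u).1 `&` (G t u).2) z by rewrite GP0.
Qed.
End compacta.

(** * Products of compacta and maps into them *)

Section products.

Lemma prod_compactum_compact (X Y : compactumType) : compact [set: X * Y].
Proof.
by rewrite -setXTT; apply: compact_setX; exact: compactumT.
Qed.

Lemma prod_compactum_hausdorff (X Y : compactumType) : hausdorff_space (X * Y)%type.
Proof.
move=> [x y] [x' y'] clxy; congr pair; apply: (@compactum_hausdorff _) => U V nU nV.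
  have [||[u v] [/= Uu Vu]] := clxy (U `*` setT) (V `*` setT).
  - by exists (U, setT) => //; split=> //; exact: filterT.
  - by exists (V, setT) => //; split=> //; exact: filterT.
  by exists u; split; [case: Uu|case: Vu].
have [||[u v] [/= Uu Vu]] := clxy (setT `*` U) (setT `*` V).
- by exists (setT, U) => //; split=> //; exact: filterT.
- by exists (setT, V) => //; split=> //; exact: filterT.
by exists v; split; [case: Uu|case: Vu].
Qed.

HB.instance Definition _ (X Y : compactumType) :=
  Topological_isCompactum.Build (X * Y)%type
    (@prod_compactum_compact X Y) (@prod_compactum_hausdorff X Y).

Lemma fst_continuous (X Y : topologicalType) : continuous (@fst X Y).
Proof. by move=> [x y]; exact: cvg_fst. Qed.

Lemma snd_continuous (X Y : topologicalType) : continuous (@snd X Y).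
Proof. by move=> [x y]; exact: cvg_snd. Qed.

Lemma pair_continuous (Z X Y : topologicalType) (f : Z -> X) (g : Z -> Y) :
  continuous f -> continuous g -> continuous (fun z => (f z, g z)).
Proof. by move=> cf cg z; apply: cvg_pair; [exact: cf|exact: cg]. Qed.

Lemma hausdorff_closed_diagonal (Y : topologicalType) : hausdorff_space Y ->
  closed [set p : Y * Y | p.1 = p.2].
Proof.
move=> hY [x y] clxy /=; apply: hY => U V nU nV.
have [|[u v] /= [uv [/= Uu Vv]]] := clxy (U `*` V); first by exists (U, V).
by exists u; split=> //; rewrite uv.
Qed.

Lemma closed_equalizer (Z Y : topologicalType) (f g : Z -> Y) :
  hausdorff_space Y -> continuous f -> continuous g ->
  closed [set z | f z = g z].
Proof.
move=> hY cf cg.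
exact: (continuous_preimage_closed (pair_continuous cf cg) (hausdorff_closed_diagonal hY)).
Qed.

Lemma closed_fibre (Z Y : topologicalType) (f : Z -> Y) (y : Y) :
  hausdorff_space Y -> continuous f -> closed [set z | f z = y].
Proof. by move=> hY cf; apply: closed_equalizer => // z; exact: cvg_cst. Qed.

Lemma prod_topology_continuous (I : Type) (K : I -> topologicalType)
    (Z : topologicalType) (f : Z -> prod_topology K) :
  (forall i, continuous (fun z => f z i)) -> continuous f.
Proof.
move=> cf z; apply/cvg_sup => i U [_ [[W oW <-] /= Wfz] sWU].
apply: filterS sWU _; exact: (cf i z _ (open_nbhs_nbhs (conj oW Wfz))).
Qed.

Lemma initial_topology_continuous (S : choiceType) (T Z : topologicalType)
    (v : S -> T) (f : Z -> initial_topology v) :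
  continuous (v \o f) -> continuous f.
Proof.
move=> cvf; apply/continuousP => _ [W oW <-].
exact: (continuous_preimage_open cvf oW).
Qed.

Lemma lim_induced_continuous d (Sigma : porderType d) (S : inverse_spectrum Sigma)
    (Z : topologicalType) (f : forall a, Z -> S a) fP :
  (forall a, continuous (f a)) -> continuous (@lim_induced d Sigma S Z f fP).
Proof.
move=> cf; apply: (@initial_topology_continuous _ (prod_topology (fun a => S a))).
exact: prod_topology_continuous.
Qed.

Lemma prod_topology_compactum_compact (I : choiceType) (K : I -> compactumType) :
  compact [set: prod_topology K].
Proof.
have := @tychonoff I (fun a => K a) (fun a => [set: K a])
  (fun a => @compactumT (K a)).
by congr compact; apply/seteqP.
Qed.

Lemma prod_topology_compactum_hausdorff (I : choiceType) (K : I -> compactumType) :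
  hausdorff_space (prod_topology K).
Proof. by apply: hausdorff_product => a; exact: compactum_hausdorff. Qed.

HB.instance Definition _ (I : choiceType) (K : I -> compactumType) :=
  Topological_isCompactum.Build (prod_topology K)
    (@prod_topology_compactum_compact I K) (@prod_topology_compactum_hausdorff I K).

End products.

Lemma countable_seq (T : choiceType) (A : set T) :
  countable A -> countable [set s : seq T | forall x, x \in s -> A x].
Proof.
move=> /countable_injP[f finj]; apply/countable_injP.
exists (fun s => choice.pickle (map f s)) => s t; rewrite !inE => sA tA.
move/(pcan_inj choice.pickleK) => /= st.
elim: s t sA tA st => [|x s IH] [|y t] //= sA tA [fxy st].
congr cons.
  by apply: finj => //; rewrite inE; [apply: sA|apply: tA]; rewrite inE eqxx.
by apply: IH => // z zs; [apply: sA|apply: tA]; rewrite inE zs orbT.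
Qed.

Lemma countable_image (T U : Type) (f : T -> U) (A : set T) :
  countable A -> countable (f @` A).
Proof. by move=> cA; apply: sub_countable cA; exact: card_image_le. Qed.

Lemma countable_mem_seq (T : choiceType) (s : seq T) : countable [set x | x \in s].
Proof. by apply: finite_set_countable; apply/finite_seqP; exists s. Qed.

(** * Skeletal maps and inverse limits *)

Section skeletal.

Lemma nowhere_dense_sub (X : topologicalType) (A B : set X) :
  A `<=` B -> nowhere_dense B -> nowhere_dense A.
Proof.
move=> AB ndB; rewrite /nowhere_dense -subset0 -ndB.
exact/interiorS/closureS.
Qed.

Lemma nowhere_dense_closure (X : topologicalType) (A : set X) :
  nowhere_dense A -> nowhere_dense (closure A).
Proof.
by rewrite /nowhere_dense => ndA; rewrite -(closure_id (closure A)).1//; exact: closed_closure.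
Qed.

Lemma open_not_nowhere_dense (X : topologicalType) (A : set X) (x : X) :
  nbhs x A -> ~ nowhere_dense A.
Proof.
move=> nA ndA; suff : set0 x by []; rewrite -ndA.
by apply: filterS nA; exact: subset_closure.
Qed.

(** For the converse, the open set to test is the interior of the closure of the preimage of [A]; it
    is mapped into [closure A], whose preimage is closed. *)
Lemma skeletalP (X Y : topologicalType) (f : X -> Y) : continuous f ->
  skeletal f <->
  forall O x, open O -> O x -> ~ nowhere_dense (f @` O).
Proof.
move=> cf; split=> [sf O x oO Ox ndO|sf A ndA].
  have /nowhere_dense_sub : O `<=` f @^-1` (f @` O) by move=> y Oy; exists y.
  move=> /(_ (sf _ ndO)).
  by apply: (@open_not_nowhere_dense _ _ x); exact: open_nbhs_nbhs.
rewrite /nowhere_dense -subset0 => x xA.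
apply: (sf _ _ (@open_interior _ _) xA).
apply: nowhere_dense_sub (nowhere_dense_closure ndA).
move=> _ [y /interior_subset yA <-].
have cl : closed (f @^-1` closure A).
  by apply: continuous_preimage_closed => //; exact: closed_closure.
apply: (cl y); apply: closureS yA => z /=; exact: subset_closure.
Qed.

Lemma skeletal_comp (X Y Z : topologicalType) (f : X -> Y) (g : Y -> Z) :
  skeletal f -> skeletal g -> skeletal (g \o f).
Proof. by move=> sf sg A /sg/sf. Qed.

Lemma skeletal_ext (X Y : topologicalType) (f g : X -> Y) :
  f =1 g -> skeletal f -> skeletal g.
Proof. by move=> /funext ->. Qed.

Lemma skeletal_factor (X Y Z : topologicalType) (f : X -> Y) (g : Y -> Z) :
  continuous f -> surjective_map f -> continuous g ->
  skeletal (g \o f) -> skeletal g.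
Proof.
move=> cf /surjective_mapP sf cg /skeletalP sgf.
apply/skeletalP => // O y oO Oy.
have [x fx] := sf y.
have cgf : continuous (g \o f) by move=> z; apply: continuous_comp; [exact: cf|exact: cg].
have := sgf cgf (f @^-1` O) x (continuous_preimage_open cf oO).
rewrite /= fx => /(_ Oy); apply: contra_not; apply: nowhere_dense_sub.
by move=> _ [z Oz <-]; exists (f z).
Qed.

Lemma skeletal_homeomorphism (X Y : topologicalType) (h : X -> Y) :
  homeomorphism h -> skeletal h.
Proof.
move=> [ch [g [cg hK gK]]]; apply/skeletalP => // O x oO Ox.
apply: (@open_not_nowhere_dense _ _ (h x)).
apply: (@filterS _ _ _ (g @^-1` O)); first by move=> y Oy; exists (g y).
apply: open_nbhs_nbhs; split; first exact: continuous_preimage_open.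
by rewrite /= hK.
Qed.

(* Two surjections of compacta with the same fibres differ by a homeomorphism. *)
Lemma skeletal_same_kernel (X Y Z : compactumType) (f : X -> Y) (g : X -> Z) :
  continuous f -> surjective_map f -> continuous g -> surjective_map g ->
  (forall x y, f x = f y <-> g x = g y) -> skeletal f -> skeletal g.
Proof.
move=> cf sf cg sg ker skf.
have [h hf] := quotient_factor cf sf cg (fun x y => (ker x y).1).
apply: (skeletal_ext (hf : (h \o f) =1 g)); apply: skeletal_comp => //.
apply: skeletal_homeomorphism; apply: continuous_bijective_homeomorphism.
- exact: cts_fun.
- move=> y z; have [x <-] := (surjective_mapP _).1 sf y.
  have [x' <-] := (surjective_mapP _).1 sf z.
  by rewrite !hf => /ker.
- apply/surjective_mapP => z; have [x <-] := (surjective_mapP _).1 sg z.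
  by exists (f x).
Qed.

End skeletal.

(** * Projections of an inverse limit of compacta *)

Section limits.

Lemma directed_set_type d (Sigma : porderType d) (A : set Sigma) :
  directed_set A -> directed_set [set: set_type A].
Proof.
move=> [[a Aa] dirA]; split; first by exists (exist _ a (mem_set Aa)).
move=> [b bA] [c cA] _ _.
have [e Ae be] := dirA b c (set_mem bA) (set_mem cA).
by exists (exist _ e (mem_set Ae)).
Qed.

(** If no index worked, the sets of points outside [O] that agree with [x] at [i] would be nonempty,
    closed and directed; a common point would agree with [x] everywhere, hence equal [x]. *)
Lemma fibre_in_open (X : compactumType) (I : Type) (M : I -> topologicalType)
    (f : forall i, X -> M i) (x : X) (O : set X) :
  (exists i : I, True) ->
  (forall i j, exists k, forall y z, f k y = f k z -> f i y = f i z /\ f j y = f j z) ->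
  (forall i, hausdorff_space (M i)) -> (forall i, continuous (f i)) ->
  (forall y z, (forall i, f i y = f i z) -> y = z) ->
  open O -> O x -> exists i, forall y, f i y = f i x -> O y.
Proof.
move=> I0 dir hM cf sep oO Ox; apply: contrapT => H.
have [||||y Dy] := @directed_closed_nonempty X I
  (fun i => [set y | f i y = f i x] `&` ~` O) => //.
- move=> i j; have [k kP] := dir i j; exists k => y [/= /kP[? ?] nOy].
  by split; split.
- move=> i; apply: closedI; last by rewrite closedC.
  exact: closed_fibre.
- move=> i; apply: contrapT => /nonemptyPn D0; apply: H; exists i => y fy.
  apply: contrapT => nOy; have : ([set y | f i y = f i x] `&` ~` O) y by [].
  by rewrite D0.
- have [i0 _] := I0; have [_] := Dy i0; apply.
  by rewrite (sep y x) // => i; case: (Dy i).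
Qed.

Lemma upper_bound_seq d (T : porderType d) (s : seq T) :
  directed_set [set: T] -> exists c, forall a, a \in s -> a <= c.
Proof.
move=> dirT; elim: s => [|a s [c cs]]; first by have [[c _] _] := dirT; exists c.
have [e _ /andP[ae ce]] := dirT.2 a c I I.
exists e => b; rewrite inE => /predU1P[-> //|/cs bc]; exact: le_trans ce.
Qed.

Context d (Sigma : porderType d) (S : inverse_spectrum Sigma).
Hypothesis dirS : directed_set [set: Sigma].

Lemma directed_le (a b : Sigma) : exists2 c, a <= c & b <= c.
Proof.
by have [c _ /andP[]] := dirS.2 a b I I; exists c.
Qed.

(** Surjectivity is compactness: the fibres of the [f a] over the coordinates of a thread are
    closed, nonempty and directed. *)
Lemma lim_induced_homeomorphism (Z : compactumType) (f : forall a, Z -> S a)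
    (fP : forall a b (ab : a <= b) z, bonding S ab (f b z) = f a z) :
  (forall a, continuous (f a)) -> (forall a, surjective_map (f a)) ->
  (forall y z, (forall a, f a y = f a z) -> y = z) ->
  homeomorphism (lim_induced fP).
Proof.
move=> cf sf sep; apply: continuous_bijective_homeomorphism.
- exact: lim_induced_continuous.
- move=> y z /(congr1 val) /= yz; apply: sep => a.
  exact: (congr1 (fun t => t a) yz).
- apply/surjective_mapP => t.
  have [||||z zP] := @directed_closed_nonempty Z Sigma
    (fun a => [set z | f a z = lim_proj a t]).
  + by have [[a _] _] := dirS; exists a.
  + move=> a b; have [c ac bc] := directed_le a b; exists c => z /= zc.
    by split=> /=; [rewrite -(fP _ _ ac)|rewrite -(fP _ _ bc)];
      rewrite zc lim_proj_bonding.
  + move=> a; apply: closed_fibre; [exact: compactum_hausdorff|exact: cf].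
  + by move=> a; exact: ((surjective_mapP _).1 (sf a) (lim_proj a t)).
  exists z; apply: val_inj; apply: functional_extensionality_dep => a.
  exact: zP.
Qed.

Lemma lim_proj_separates (x y : spectrum_lim S) :
  (forall a, lim_proj a x = lim_proj a y) -> x = y.
Proof. by move=> xy; apply: val_inj; apply: functional_extensionality_dep. Qed.

Lemma lim_proj_directed (a b : Sigma) : exists c, forall x y : spectrum_lim S,
  lim_proj c x = lim_proj c y ->
  lim_proj a x = lim_proj a y /\ lim_proj b x = lim_proj b y.
Proof.
have [c ac bc] := directed_le a b; exists c => x y xy.
by rewrite -!(lim_proj_bonding ac) -!(lim_proj_bonding bc) xy.
Qed.

Hypothesis surjS : forall a b (ab : a <= b), surjective_map (bonding S ab).

Local Notation prodS := (prod_topology (fun a => S a)).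

Lemma lim_proj_surjective a : surjective_map (lim_proj (S := S) a).
Proof.
apply/surjective_mapP => y.
(* Coordinates at indices not below the current one are filled arbitrarily, so every stage has to be
   inhabited. *)
have pt b : exists z : S b, True.
  have [c ac bc] := directed_le a b.
  have [z _] := (surjective_mapP _).1 (surjS ac) y.
  by exists (bonding S bc z).
(* [D c] holds the points over [y] whose coordinates below [c] are determined by the one at [c]; a
   point common to all [D c] is a thread. *)
pose D (c : {c | a <= c}) : set prodS :=
  [set x   : prodS | x a = y /\
    forall b (bc : b <= val c), bonding S bc (x (val c)) = x b].
have proj_cts b : continuous (fun x   : prodS => x b).
  exact: (@proj_continuous _ (fun b => S b) b).
have [||||x xP] := @directed_closed_nonempty (prod_topology (fun b => S b)) _ D.
- by exists (exist _ a (lexx a)).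
- move=> [c ac] [c' ac']; have [e ce ce'] := directed_le c c'.
  exists (exist _ e (le_trans ac ce)) => x [/= xa xb]; split; split => //= b bc.
    by rewrite -(xb c ce) (bonding_comp _ _ (le_trans bc ce)) xb.
  by rewrite -(xb c' ce') (bonding_comp _ _ (le_trans bc ce')) xb.
- move=> [c ac]; rewrite /D /=.
  apply: closedI.
    by apply: closed_fibre; [exact: compactum_hausdorff|exact: proj_cts].
  rewrite [X in closed X](_ : _ = \bigcap_(b in setT) \bigcap_(bc in [set: b <= c])
      [set x   : prodS | bonding S bc (x c) = x b]).
    apply: closed_bigI => b _; apply: closed_bigI => bc _.
    apply: closed_equalizer; [exact: compactum_hausdorff| |exact: proj_cts].
    by move=> x; apply: continuous_comp; [exact: proj_cts|exact: cts_fun].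
  apply/seteqP; split=> x /= xP; first by move=> b _ bc _; exact: xP.
  by move=> b bc; exact: xP.
- move=> [c ac]; have [z zy] := (surjective_mapP _).1 (surjS ac) y.
  have xb b : exists t : S b, forall bc : b <= c, bonding S bc z = t.
    have [bc|nbc] := pselect (b <= c); last by have [t _] := pt b; exists t.
    by exists (bonding S bc z) => bc'; rewrite (Prop_irrelevance bc bc').
  pose x   : prodS := fun b => projT1 (cid (xb b)).
  have xE b (bc : b <= c) : bonding S bc z = x b by rewrite /x; case: cid.
  have xc : x c = z by rewrite -(xE c (lexx c)) bonding_id.
  exists x; split=> [|b bc] /=; first by rewrite -(xE a ac).
  by rewrite xc xE.
have thx : threads (S := S) x.
  move=> b c bc; have [e ae ce] := directed_le a c.
  have [_ /= xe] := xP (exist _ e ae).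
  by rewrite -(xe c ce) (bonding_comp _ _ (le_trans bc ce)) xe.
exists (exist _ x (mem_set thx)); rewrite /lim_proj /=.
by have [] := xP (exist _ a (lexx a)).
Qed.

(** By compactness a nonempty open set contains the preimage of a nonempty open set at some stage
    above [a], and the bonding map from that stage is skeletal. *)
Lemma lim_proj_skeletal a : (forall a b (ab : a <= b), skeletal (bonding S ab)) ->
  skeletal (lim_proj (S := S) a).
Proof.
move=> skS; apply/skeletalP; first exact: lim_proj_continuous.
move=> O x oO Ox.
have [|||||||b bP] := @fibre_in_open (spectrum_lim S) Sigma (fun b => S b)
    (fun b => lim_proj b) x O.
- by exists a.
- exact: lim_proj_directed.
- by move=> b; exact: compactum_hausdorff.
- by move=> b; exact: lim_proj_continuous.
- exact: lim_proj_separates.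
- exact: oO.
- exact: Ox.
have [c ac bc] := directed_le a b.
(* The projection is a closed map, so the set [W] of points whose whole fibre lies in [O] is
   open. *)
pose W := ~` (lim_proj (S := S) c @` (~` O)).
have oW : open W.
  rewrite openC; apply: continuous_image_closed; first exact: lim_proj_continuous.
  by rewrite closedC.
have Wx : W (lim_proj c x).
  move=> [z nOz zx]; apply: nOz; apply: bP.
  by rewrite -!(lim_proj_bonding bc) zx.
have /skeletalP -/(_ (@cts_fun _ _ _)) sk := skS a c ac.
have := sk W _ oW Wx; apply: contra_not; apply: nowhere_dense_sub.
move=> _ [w Ww <-]; have [z zw] := (surjective_mapP _).1 (lim_proj_surjective c) w.
exists z; last by rewrite -zw lim_proj_bonding.
by apply: contrapT => nOz; apply: Ww; exists z.
Qed.

End limits.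

(** * Second countability and metrizability *)

Section second_countability.

(** The pairs are the disjoint ones among closures of basic sets; regularity makes them separate
    points. *)
Lemma second_countable_pairs (Z : compactumType) : @second_countable Z ->
  exists2 C : set (set Z * set Z), countable C &
    (forall PQ, C PQ -> [/\ closed PQ.1, closed PQ.2 & PQ.1 `&` PQ.2 = set0]) /\
    forall x y, x <> y -> exists2 PQ, C PQ & PQ.1 x /\ PQ.2 y.
Proof.
move=> [B cB [oB nB]].
exists [set PQ | (closure @` B `*` closure @` B) PQ /\ PQ.1 `&` PQ.2 = set0].
  apply: (@sub_countable _ _ _ (closure @` B `*` closure @` B)).
    by apply: subset_card_le => PQ [].
  by apply: countableX; apply: countable_image.
split=> [[P Q] /= [[[U BU <-] [V BV <-]] PQ]|x y xy].
  by split=> //; exact: closed_closure.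
have [U [V [nU nV UV]]] := hausdorff_separated (@compactum_hausdorff Z) xy.
have [K cK [nK KU]] := closed_nbhs nU.
have [L cL [nL LV]] := closed_nbhs nV.
have [U' [BU' U'x] U'K] := nB x _ nK.
have [V' [BV' V'y] V'L] := nB y _ nL.
exists (closure U', closure V') => /=; last by split; exact: subset_closure.
split; first by split=> /=; [exists U'|exists V'].
apply/seteqP; split=> // z [/(closureS U'K) + /(closureS V'L)].
rewrite -!(closure_id _).1 // => /KU Uz /LV Vz.
by suff : (U `&` V) z by rewrite UV.
Qed.

(** Preimages of basic sets generate a Hausdorff topology coarser than the compact one, so the two
    coincide; concretely, finite intersections of such preimages form a basis. *)
Lemma second_countable_separating (X : compactumType) (J : Type) (A : set J)
    (M : J -> topologicalType) (f : forall j, X -> M j) :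
  countable A -> (forall j, A j -> hausdorff_space (M j)) ->
  (forall j, A j -> @second_countable (M j)) ->
  (forall j, A j -> continuous (f j)) ->
  (forall x y, (forall j, A j -> f j x = f j y) -> x = y) ->
  @second_countable X.
Proof.
move=> cA hM scM cf sep.
have Bx j : exists B : set (set (M j)), A j -> countable B /\ basis B.
  have [Aj|nAj] := pselect (A j); last by exists set0.
  by have [B cB bB] := scM j Aj; exists B.
pose B j := projT1 (cid (Bx j)).
have BP j : A j -> countable (B j) /\ basis (B j).
  by move=> Aj; rewrite /B; case: cid => ? /= /(_ Aj).
pose G := \bigcup_(j in A) ((preimage (f j)) @` B j).
have cG : countable G.
  by apply: bigcup_countable => // j Aj; apply: countable_image; exact: (BP j Aj).1.
have oG U : G U -> open U.
  move=> [j Aj [V BV <-]]; apply: continuous_preimage_open; first exact: cf.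
  exact: (BP j Aj).2.1.
pose inter (s : seq (set X)) := \big[setI/setT]_(U <- s) U.
have interP s x : inter s x <-> forall U, U \in s -> U x.
  rewrite /inter; elim: s => [|U s IH]; first by rewrite big_nil.
  rewrite big_cons; split=> [[Ux /IH sx] V|sx].
    by rewrite inE => /orP[/eqP ->|/sx].
  split; first by apply: sx; rewrite inE eqxx.
  by apply/IH => V Vs; apply: sx; rewrite inE Vs orbT.
exists (inter @` [set s : seq (set X) | forall U, U \in s -> G U]).
  exact/countable_image/countable_seq.
split=> [_ [s sG <-]|x O].
  elim: s sG => [|U s IH] sG; first by rewrite /inter big_nil; exact: openT.
  rewrite /inter big_cons; apply: openI.
    by apply: oG; apply: sG; rewrite inE eqxx.
  by apply: IH => V Vs; apply: sG; rewrite inE Vs orbT.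
rewrite nbhsE => -[Q [oQ Qx] QO].
have H y : y <> x -> exists U V, [/\ G U, U x, nbhs y V & U `&` V = set0].
  move=> yx; have [j [Aj fj]] : exists j, A j /\ f j y <> f j x.
    apply: contrapT => /forallNP H; apply: yx; apply: sep => j Aj.
    by apply: contrapT => fj; apply: (H j).
  have [V [U [nV nU VU]]] := hausdorff_separated (hM j Aj) fj.
  have [oB nB] := (BP j Aj).2.
  have [W [BW Wx] WU] := nB (f j x) _ nU.
  exists (f j @^-1` W), (f j @^-1` V); split=> //.
  - by exists j => //; exists W.
  - by apply: (cf j Aj).
  - apply/seteqP; split=> // z [/= /WU Uz Vz].
    by suff : (V `&` U) (f j z) by rewrite VU.
have [s [sG sx sO]] : exists s : seq (set X), [/\ (forall U, U \in s -> G U),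
    inter s x & inter s `<=` Q].
  (* Otherwise the closures of the finite intersections around [x] share a point [y] outside [Q],
     but some generator around [x] misses a neighbourhood of [y]. *)
  apply: contrapT => nos.
  have nil0 : (forall U, U \in [::] -> G U) /\ inter [::] x.
    by split=> //; apply/interP.
  have [||||y yP] := @directed_closed_nonempty X
    {s : seq (set X) | (forall U, U \in s -> G U) /\ inter s x}
    (fun s => closure (inter (sval s)) `&` ~` Q).
  - by exists (exist _ [::] nil0).
  - move=> [s [sG sx]] [t [tG tx]].
    have stG U : U \in s ++ t -> G U by rewrite mem_cat => /orP[/sG|/tG].
    have stx : inter (s ++ t) x.
      by apply/interP => U; rewrite mem_cat => /orP[]; move: U; apply/interP.
    exists (exist _ (s ++ t) (conj stG stx)) => z [/= stz Qz].
    split; split=> //; apply: closureS stz => w /interP stw;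
      by apply/interP => U Us; apply: stw; rewrite mem_cat Us ?orbT.
  - by move=> s; apply: closedI; [exact: closed_closure|rewrite closedC].
  - move=> [s [sG sx]] /=; apply: contrapT => /nonemptyPn s0; apply: nos.
    exists s; split=> // z sz; apply: contrapT => nQz.
    suff : (closure (inter s) `&` ~` Q) z by rewrite s0.
    by split=> //; exact: subset_closure.
  have [|U [V [GU Ux nV UV]]] := H y.
    move=> yx; have := yP (exist _ [::] nil0).
    by case => _; rewrite yx; apply.
  have sU : (forall W, W \in [:: U] -> G W) /\ inter [:: U] x.
    by split; [|apply/interP]; move=> W; rewrite inE => /eqP ->.
  have [/= + _] := yP (exist _ [:: U] sU).
  move=> /(_ _ nV)[z [+ Vz]] => /interP/(_ U); rewrite inE eqxx => /(_ isT) Uz.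
  by suff : (U `&` V) z by rewrite UV.
exists (inter s); first by split=> //; exists s.
by move=> z /sO/QO.
Qed.

(** Every basis contains the singleton of each isolated point. *)
Lemma isolated_points_countable (Y : compactumType) :
  @second_countable Y -> countable [set y : Y | open [set y]].
Proof.
move=> [B cB [oB nB]].
have inj : {in [set y : Y | open [set y]] &, injective (@set1 Y)}.
  move=> y z _ _ yz; have : [set z] y by rewrite -yz.
  by [].
rewrite -(eq_countable (inj_card_eq inj)).
apply: sub_countable cB; apply: subset_card_le => _ [y oy <-].
have [U [BU Uy] Uy1] := nB y _ (open_nbhs_nbhs (conj oy (erefl : [set y] y))).
suff -> : [set y] = U by [].
by apply/seteqP; split=> // _ ->.
Qed.

(** For each of countably many disjoint closed pairs in [Z], compactness of [X * X] yields finitely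
    many indices that distinguish the two preimages; [A] collects them all. *)
Lemma countable_separation (X Z : compactumType) (J : choiceType)
    (M : J -> topologicalType) (f : forall j, X -> M j) (g : X -> Z) :
  (forall j, hausdorff_space (M j)) -> (forall j, continuous (f j)) ->
  (forall x y, (forall j, f j x = f j y) -> x = y) ->
  continuous g -> @second_countable Z ->
  exists2 A : set J, countable A &
    forall x y, (forall j, A j -> f j x = f j y) -> g x = g y.
Proof.
move=> hM cf sep cg /second_countable_pairs[C cC [CP Csep]].
have H (PQ : set Z * set Z) : exists s : seq J, C PQ ->
    forall x y, PQ.1 (g x) -> PQ.2 (g y) -> ~ (forall j, j \in s -> f j x = f j y).
  have [/CP[cP cQ PQ0]|nC] := pselect (C PQ); last by exists [::].
  apply: contrapT => nos.
  pose D (s : seq J) := [set p : X * X | [/\ PQ.1 (g p.1), PQ.2 (g p.2) &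
     forall j, j \in s -> f j p.1 = f j p.2]].
  have [||||[x y] xyP] := @directed_closed_nonempty (X * X)%type (seq J) D.
  - by exists [::].
  - move=> s t; exists (s ++ t) => -[x y] [/= Px Qy st].
    by split; split=> //= j js; apply: st; rewrite mem_cat js ?orbT.
  - move=> s; rewrite [X in closed X](_ : _ = [set p | PQ.1 (g p.1)] `&`
      ([set p | PQ.2 (g p.2)] `&`
       \bigcap_(j in [set j | j \in s]) [set p | f j p.1 = f j p.2])).
      apply: closedI.
        apply: (continuous_preimage_closed _ cP) => p.
        by apply: continuous_comp; [exact: fst_continuous|exact: cg].
      apply: closedI.
        apply: (continuous_preimage_closed _ cQ) => p.
        by apply: continuous_comp; [exact: snd_continuous|exact: cg].
      apply: closed_bigI => j _; apply: closed_equalizer; first exact: hM.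
        by move=> p; apply: continuous_comp; [exact: fst_continuous|exact: cf].
      by move=> p; apply: continuous_comp; [exact: snd_continuous|exact: cf].
    by apply/seteqP; split=> p; [case=> ? ? ?; split|case=> ? [? ?]; split].
  - move=> s; apply: contrapT => /nonemptyPn D0; apply: nos.
    exists s => _ x y Px Qy st; suff : D s (x, y) by rewrite D0.
    by [].
  have xy : x = y.
    apply: sep => j; have [_ _ /(_ j)] := xyP [:: j].
    by rewrite inE eqxx; exact.
  have [/= Px Qy _] := xyP [::]; rewrite -xy in Qy.
  by suff : (PQ.1 `&` PQ.2) (g x) by rewrite PQ0.
have [s sP] := choice H.
exists (\bigcup_(PQ in C) [set j | j \in s PQ]).
  apply: bigcup_countable => // PQ _.
  exact: countable_mem_seq.
move=> x y xy; apply: contrapT => /Csep[PQ CPQ [Px Qy]].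
by apply: (sP PQ CPQ x y Px Qy) => j js; apply: xy; exists PQ.
Qed.

End second_countability.

(** * Metrization of second countable compacta *)

Section metrization.
Import GRing.Theory Num.Theory.
Context (R : realType) (X : compactumType) (F : nat -> X -> R).
Hypothesis F01 : forall n x, (0 <= F n x <= 1)%R.
Hypothesis F_continuous : forall n, continuous (F n).
Hypothesis F_separates : forall x y, (forall n, F n x = F n y) -> x = y.

Local Open Scope ring_scope.

Let term x y n := `|F n x - F n y| / n.+1%:R.

(** A metric for the initial topology of the sequence [F]: the weights tend to zero, so up to a
    given error only finitely many [F n] matter. *)
Definition weighted_sup x y : R := sup (range (term x y)).

Let term_ge0 x y n : 0 <= term x y n.
Proof. by rewrite /term divr_ge0. Qed.

Let term_le x y n : term x y n <= n.+1%:R^-1.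
Proof.
rewrite /term ler_piMl ?invr_ge0//.
have /andP[? ?] := F01 n x; have /andP[? ?] := F01 n y.
rewrite ler_norml; apply/andP; split; lra.
Qed.

Let term_le1 x y n : term x y n <= 1.
Proof.
by apply: (le_trans (term_le x y n)); rewrite invf_le1 ?ltr0n// ler1n.
Qed.

Let term_sup x y n : term x y n <= weighted_sup x y.
Proof.
apply: ub_le_sup; last by exists n.
by exists 1 => _ [m _ <-]; exact: term_le1.
Qed.

Let weighted_sup_le x y e : (forall n, term x y n <= e) -> weighted_sup x y <= e.
Proof.
move=> te; apply: ge_sup; first by exists (term x y 0%N), 0%N.
by move=> _ [n _ <-].
Qed.

Let weighted_supxx x : weighted_sup x x = 0.
Proof.
apply/le_anti/andP; split.
  by apply: weighted_sup_le => n; rewrite /term subrr normr0 mul0r.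
exact: le_trans (term_ge0 x x 0%N) (term_sup x x 0%N).
Qed.

Let weighted_sup_positivity x y : weighted_sup x y = 0 -> x = y.
Proof.
move=> d0; apply: F_separates => n.
have : term x y n = 0.
  by apply/le_anti/andP; split=> //; rewrite -d0.
by move/eqP; rewrite /term mulf_eq0 invr_eq0 pnatr_eq0 orbF normr_eq0 subr_eq0 => /eqP.
Qed.

Let weighted_sup_sym x y : weighted_sup x y = weighted_sup y x.
Proof.
rewrite /weighted_sup (_ : term x y = term y x)//.
by apply/funext => n; rewrite /term distrC.
Qed.

Let weighted_sup_triangle y x z :
  weighted_sup x z <= weighted_sup x y + weighted_sup y z.
Proof.
apply: weighted_sup_le => n.
apply: (le_trans _ (lerD (term_sup x y n) (term_sup y z n))).
by rewrite /term -mulrDl ler_wpM2r// ?invr_ge0// ler_distD.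
Qed.

(* The hypotheses are kept as parameters of the carrier so that the metric
   structure can be attached to it. *)
Definition metrized : Type :=
  let _ := (weighted_supxx, weighted_sup_positivity) in X.

HB.instance Definition _ := Choice.on metrized.
HB.instance Definition _ := @isMetric.Build R metrized weighted_sup
  weighted_supxx weighted_sup_positivity weighted_sup_sym weighted_sup_triangle.

Lemma metrized_homeomorphic : homeomorphic X metrized.
Proof.
exists (fun x => x : metrized).
apply: continuous_bijective_homeomorphism_hausdorff => //.
- exact: metric_hausdorff.
- move=> x U /= /nbhs_ballP[e /= e0 xeU].
  (* A strict bound on all terms gives only a weak bound on their supremum, hence [e / 2] rather
     than [e]. *)
  have e20 : 0 < e / 2 by rewrite divr_gt0.
  have [N _ NP] := near_infty_natSinv_lt (PosNum e20).
  have near_le : \forall y \near x, forall n : 'I_N.+1, `|F n x - F n y| < e / 2.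
    apply: filter_forall => n.
    by have /cvgrPdist_lt/(_ _ e20) := @F_continuous n x.
  apply: filterS near_le => y yP; apply: xeU; rewrite ballEmdist /=.
  apply: (@le_lt_trans _ _ (e / 2)); last by rewrite ltr_pdivrMr// ltr_pMr// ltr1n.
  apply: weighted_sup_le => n; have [nN|Nn] := leqP n N.
    apply: ltW; apply: le_lt_trans (yP (Ordinal (nN : (n < N.+1)%N))).
    by rewrite /term ler_pdivrMr// ler_peMr// ler1n.
  apply: le_trans (term_le _ _ _) _; apply: ltW.
  by apply: NP => /=; exact: ltnW.
- by apply/surjective_mapP => y; exists y.
Qed.

End metrization.

(** The sequence fed to the metrization consists of Urysohn functions of countably many closed pairs
    that separate points. *)
Lemma second_countable_metrizable (R : realType) (X : compactumType) :
  @second_countable X -> metrizable R X.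
Proof.
move=> /second_countable_pairs[C cC [CP Csep]].
have [g gC] : exists g : nat -> set X * set X, forall PQ, C PQ -> exists n, g n = PQ.
  have /pfcard_geP[->|/unsquash g] : (C #<= [set: nat])%card by exact: cC.
    by exists (fun=> (set0, set0)).
  exists g => PQ CPQ.
  by have [n _ <-] := @surj _ _ _ _ g _ CPQ; exists n.
have nX : normal_space X.
  by apply: compact_normal; [exact: compactum_hausdorff|exact: compactumT].
pose F n : X -> R := Urysohn (g n).1 (g n).2.
have F01 n x : (0 <= F n x <= 1)%R.
  have : `[0%R, 1%R]%classic (F n x) by apply: (@Urysohn_range _ R); exists x.
  by rewrite /= in_itv.
have cF n : continuous (F n) by exact: Urysohn_continuous.
have sepF x y : (forall n, F n x = F n y) -> x = y.
  move=> Fxy; apply: contrapT => /Csep[PQ CPQ [Px Qy]].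
  have [n gn] := gC PQ CPQ; have [cP cQ PQ0] := CP PQ CPQ.
  have us := normal_uniform_separator nX cP cQ PQ0.
  have F0 : F n x = 0%R.
    by apply: (@Urysohn_sub0 _ R _ _ us); exists x; rewrite // /F gn.
  have F1 : F n y = 1%R.
    by apply: (@Urysohn_sub1 _ R _ _ us); exists y; rewrite // /F gn.
  have := Fxy n; rewrite F0 F1 => /esym/eqP.
  by rewrite GRing.oner_eq0.
by exists (metrized F01 sepF); exact: metrized_homeomorphic.
Qed.

Lemma real_second_countable (R : realType) : @second_countable R.
Proof.
pose I (pq : rat * rat) : set R := `]ratr pq.1, ratr pq.2[%classic.
exists (I @` setT); first exact/countable_image/countableP.
split=> [_ [pq _ <-]|x U /nbhs_ballP[e /= e0 xeU]]; first exact: interval_open.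
have [|p] := @rat_in_itvoo R (x - e)%R x; first lra.
rewrite in_itv /= => /andP[p1 p2].
have [|q] := @rat_in_itvoo R x (x + e)%R; first lra.
rewrite in_itv /= => /andP[q1 q2].
exists (I (p, q)); first split.
- by exists (p, q).
- by rewrite /I /= in_itv /= p2 q1.
- move=> y; rewrite /I /= in_itv /= => /andP[py yq]; apply: xeU.
  by rewrite /ball /= Num.Theory.ltr_norml; apply/andP; split; lra.
Qed.

Lemma real_maps_separate (R : realType) (X : compactumType) (x y : X) :
  (forall f : continuousType X R, f x = f y) -> x = y.
Proof.
move=> xy; apply: contrapT => nxy.
have nX : normal_space X.
  by apply: compact_normal; [exact: compactum_hausdorff|exact: compactumT].
have us : uniform_separator [set x] [set y].
  apply: normal_uniform_separator => //; try exact: closed_singleton.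
  by apply/seteqP; split=> // z [/= -> ].
have F0 : (Urysohn [set x] [set y] : X -> R) x = 0%R.
  by apply: (@Urysohn_sub0 _ R _ _ us); exists x.
have F1 : (Urysohn [set x] [set y] : X -> R) y = 1%R.
  by apply: (@Urysohn_sub1 _ R _ _ us); exists y.
have /esym/eqP : 0%R = 1%R :> R.
  rewrite -F0 -F1; exact: xy (mkcts (@Urysohn_continuous X R [set x] [set y])).
by rewrite GRing.oner_eq0.
Qed.

Lemma bool_second_countable : @second_countable bool.
Proof.
exists (range (@set1 bool)); first exact/countable_image/countableP.
split=> [U _|b U nU]; first exact: discrete_open.
exists [set b]; first by split=> //; exists b.
by move=> _ ->; exact: nbhs_singleton.
Qed.

(** * Quotients by countable families of maps *)

Section quotients.
Local Open Scope quotient_scope.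
Context (X : compactumType) (J : Type) (M : J -> topologicalType).
Variable f : forall j, continuousType X (M j).
Hypothesis M_hausdorff : forall j, hausdorff_space (M j).

Definition same_fibre (A : set J) : rel X :=
  fun x y => `[< forall j, A j -> f j x = f j y >].

Lemma same_fibre_equiv A : equiv_class_of (same_fibre A).
Proof.
split=> [x|x y|y x z].
- exact/asboolP.
- by apply/asboolP/asboolP => xy j Aj; rewrite xy.
- by move=> /asboolP xy /asboolP yz; apply/asboolP => j Aj; rewrite xy// yz.
Qed.

Canonical same_fibre_equiv_rel A := EquivRelPack (same_fibre_equiv A).

Definition fibre_space (A : set J) : Type :=
  quotient_topology {eq_quot (same_fibre_equiv_rel A)}.

HB.instance Definition _ A := Topological.on (fibre_space A).
HB.instance Definition _ A := Quotient.on (fibre_space A).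

Definition fibre_proj A (x : X) : fibre_space A := \pi_(fibre_space A) x.

Lemma fibre_proj_continuous A : continuous (fibre_proj A).
Proof. exact: pi_continuous. Qed.

HB.instance Definition _ A := isContinuous.Build X (fibre_space A) (fibre_proj A)
  (@fibre_proj_continuous A).

Lemma fibre_proj_eq A x y :
  fibre_proj A x = fibre_proj A y <-> forall j, A j -> f j x = f j y.
Proof.
suff H : x = y %[mod {eq_quot (same_fibre_equiv_rel A)}] <->
    (forall j, A j -> f j x = f j y) by [].
by split=> [/eqmodP/asboolP //|xy]; apply/eqmodP/asboolP.
Qed.

Lemma fibre_proj_surjective A : surjective_map (fibre_proj A).
Proof.
by apply/surjective_mapP => y; exists (repr y); rewrite /fibre_proj reprK.
Qed.

Lemma fibre_space_factor A (Z : topologicalType) (g : X -> Z) :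
  continuous g -> (forall x y, fibre_proj A x = fibre_proj A y -> g x = g y) ->
  exists h : continuousType (fibre_space A) Z, forall x, h (fibre_proj A x) = g x.
Proof.
move=> cg gA.
have cr : continuous (g \o repr : fibre_space A -> Z).
  by apply: repr_comp_continuous => // x y /eqP xy; apply/eqP; exact: gA.
by exists (mkcts cr) => x /=; apply: gA; rewrite /fibre_proj reprK.
Qed.

Lemma fibre_space_coordinates A : exists h : forall j, fibre_space A -> M j,
  forall j, A j -> continuous (h j) /\ forall x, h j (fibre_proj A x) = f j x.
Proof.
have H j : exists h : fibre_space A -> M j, A j ->
    continuous h /\ forall x, h (fibre_proj A x) = f j x.
  have [Aj|nAj] := pselect (A j).
    have [||h hP] := @fibre_space_factor A (M j) (f j).
    - exact: cts_fun.
    - by move=> x y /fibre_proj_eq; exact.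
    - by exists h => _; split=> //; exact: cts_fun.
  (* A placeholder for [j] outside [A]; it goes through a representative because [M j] has no
     distinguished point. *)
  by exists (fun y => f j (repr y)).
by exists (fun j => projT1 (cid (H j))) => j; case: cid.
Qed.

Lemma fibre_space_compact A : compact [set: fibre_space A].
Proof.
rewrite -(fibre_proj_surjective A); apply: continuous_compact.
  exact/continuous_subspaceT/fibre_proj_continuous.
exact: compactumT.
Qed.

Lemma fibre_space_hausdorff A : hausdorff_space (fibre_space A).
Proof.
have [h hP] := fibre_space_coordinates A.
have /surjective_mapP sq := fibre_proj_surjective A.
move=> y z; have [x <-] := sq y; have [x' <-] := sq z => cl.
apply/fibre_proj_eq => j Aj; have [ch hq] := hP j Aj.
rewrite -!hq; apply: (M_hausdorff (j := j)) => U V nU nV.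
by have [w [Uw Vw]] := cl _ _ (ch _ _ nU) (ch _ _ nV); exists (h j w).
Qed.

Definition fibre_compactum A : compactumType :=
  HB.pack (fibre_space A) (Topological_isCompactum.Build (fibre_space A)
    (@fibre_space_compact A) (@fibre_space_hausdorff A)).

Lemma fibre_compactum_second_countable A : countable A ->
  (forall j, A j -> @second_countable (M j)) ->
  @second_countable (fibre_compactum A).
Proof.
move=> cA scM; have [h hP] := fibre_space_coordinates A.
apply: (@second_countable_separating (fibre_compactum A) J A M h) => //.
  by move=> j Aj; exact: (hP j Aj).1.
have /surjective_mapP sq := fibre_proj_surjective A.
move=> y z; have [x <-] := sq y; have [x' <-] := sq z => hxy.
apply/fibre_proj_eq => j Aj; have [_ hq] := hP j Aj.
by rewrite -!hq; exact: hxy.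
Qed.

Lemma fibre_bonding_ex (A B : set J) : A `<=` B ->
  exists h : continuousType (fibre_compactum B) (fibre_compactum A),
    forall x, h (fibre_proj B x) = fibre_proj A x.
Proof.
move=> AB; have [||h hP] := @fibre_space_factor B (fibre_compactum A) (fibre_proj A).
- exact: fibre_proj_continuous.
- by move=> x y /fibre_proj_eq xy; apply/fibre_proj_eq => j /AB/xy.
- by exists h.
Qed.

Definition fibre_bonding (A B : set J) (AB : A `<=` B) :=
  projT1 (cid (fibre_bonding_ex AB)).

Lemma fibre_bondingE (A B : set J) (AB : A `<=` B) x :
  fibre_bonding AB (fibre_proj B x) = fibre_proj A x.
Proof. by rewrite /fibre_bonding; case: cid. Qed.

Context d (T : porderType d) (K : T -> set J).
Hypothesis K_mono : forall s t, s <= t -> K s `<=` K t.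

Program Definition fibre_spectrum : inverse_spectrum T :=
  @InverseSpectrum d T (fun t => fibre_compactum (K t))
    (fun s t st => fibre_bonding (K_mono st)) _ _.
Next Obligation.
move=> a aa y; have [x <-] := (surjective_mapP _).1 (fibre_proj_surjective (K a)) y.
exact: fibre_bondingE.
Qed.
Next Obligation.
move=> a b c ab bc ac y.
have [x <-] := (surjective_mapP _).1 (fibre_proj_surjective (K c)) y.
by rewrite !fibre_bondingE.
Qed.

Lemma fibre_spectrum_bonding_surjective a b (ab : a <= b) :
  surjective_map (bonding fibre_spectrum ab).
Proof.
apply/surjective_mapP => y.
have [x <-] := (surjective_mapP _).1 (fibre_proj_surjective (K a)) y.
by exists (fibre_proj (K b) x); exact: fibre_bondingE.
Qed.

Lemma fibre_spectrum_bonding_skeletal a b (ab : a <= b) :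
  skeletal (fibre_proj (K a)) -> skeletal (bonding fibre_spectrum ab).
Proof.
move=> sk; apply: (@skeletal_factor _ _ _ (fibre_proj (K b) : X -> fibre_compactum (K b))).
- exact: fibre_proj_continuous.
- exact: fibre_proj_surjective.
- exact: cts_fun.
- apply: skeletal_ext sk => x; exact/esym/fibre_bondingE.
Qed.

(** When the index set at a supremum is covered by the earlier ones, points of its quotient that
    agree at all earlier stages are equal. *)
Lemma fibre_spectrum_omega_continuous :
  (forall (A : set T) g, isLub A g -> countable A -> directed_set A ->
     K g `<=` \bigcup_(a in A) K a) ->
  omega_continuous fibre_spectrum.
Proof.
move=> K_sup A g lub cA dirA.
apply: lim_induced_homeomorphism.
- exact: directed_set_type.
- by move=> a; exact: cts_fun.
- by move=> a; exact: fibre_spectrum_bonding_surjective.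
move=> y z.
have [x <-] := (surjective_mapP _).1 (fibre_proj_surjective (K g)) y.
have [x' <-] := (surjective_mapP _).1 (fibre_proj_surjective (K g)) z => xx'.
apply/fibre_proj_eq => j /(K_sup A g lub cA dirA)[a Aa Kaj].
have := xx' (exist _ a (mem_set Aa)).
by rewrite /= !fibre_bondingE => /fibre_proj_eq; exact.
Qed.

Lemma fibre_spectrum_limit : directed_set [set: T] ->
  (forall x y, (forall t j, K t j -> f j x = f j y) -> x = y) ->
  homeomorphic X (spectrum_lim fibre_spectrum).
Proof.
move=> dirT sep.
have qP a b (ab : a <= b) x :
    bonding fibre_spectrum ab (fibre_proj (K b) x) = fibre_proj (K a) x.
  exact: fibre_bondingE.
exists (lim_induced (S := fibre_spectrum) qP).
apply: lim_induced_homeomorphism => //.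
- by move=> a; exact: fibre_proj_continuous.
- by move=> a; exact: fibre_proj_surjective.
- by move=> x y xy; apply: sep => t; apply/fibre_proj_eq; exact: xy.
Qed.

End quotients.

Lemma subfamily_leE (J : Type) (P : set (set J)) (E F : set_type P) :
  (E <= F) = (val E `<=` val F) :> Prop.
Proof. by rewrite -subsetEset. Qed.

Lemma union_closed_directed (J : Type) (P : set (set J)) :
  P set0 -> (forall A B, P A -> P B -> P (A `|` B)) ->
  directed_set [set: set_type P].
Proof.
move=> P0 PU; split; first by exists (exist _ set0 (mem_set P0)).
move=> A B _ _; have PAB := PU _ _ (set_mem (valP A)) (set_mem (valP B)).
exists (exist _ (val A `|` val B) (mem_set PAB)) => //.
by apply/andP; split; rewrite subfamily_leE => j; [left|right].
Qed.

(** * Countable index sets closed under a countable-valued operation *)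

Section closed_subsets.
Context (J : choiceType) (phi : seq J -> set J).
Hypothesis phi_countable : forall s, countable (phi s).

Definition closed_under (E : set J) :=
  forall s : seq J, (forall x, x \in s -> E x) -> phi s `<=` E.

Definition closed_subsets : set (set J) :=
  [set E | countable E /\ closed_under E].

Definition hull_step (E : set J) :=
  E `|` \bigcup_(s in [set s : seq J | forall x, x \in s -> E x]) phi s.

Definition hull (E : set J) := \bigcup_n iter n hull_step E.

Lemma hull_countable E : countable E -> countable (hull E).
Proof.
move=> cE; apply: bigcup_countable => // n _.
elim: n => [//|n IH]; rewrite iterS; move: (iter n _ _) IH => {cE}E cE.
rewrite /hull_step -bigcup2E; apply: bigcup_countable => // -[|[|i]] _ //=.
by apply: bigcup_countable => //; exact: countable_seq.
Qed.

Lemma hull_sub E : E `<=` hull E.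
Proof. by move=> x Ex; exists 0%N. Qed.

(** The stages increase, so a finite sequence from the hull lies in one stage and its [phi] in the
    next. *)
Lemma hull_closed_under E : closed_under (hull E).
Proof.
have mono n m : (n <= m)%N -> iter n hull_step E `<=` iter m hull_step E.
  elim: m => [|m IH]; first by rewrite leqn0 => /eqP ->.
  rewrite leq_eqVlt ltnS => /predU1P[-> //|/IH nm] x /nm ?.
  by rewrite iterS; left.
move=> s sE; have [n sn] : exists n, forall x, x \in s -> iter n hull_step E x.
  elim: s sE => [|x s IH] sE; first by exists 0%N.
  have [|n sn] := IH; first by move=> y ys; apply: sE; rewrite inE ys orbT.
  have [m _ xm] : hull E x by apply: sE; rewrite inE eqxx.
  exists (maxn n m) => y; rewrite inE => /predU1P[->|/sn].
    by apply: mono xm; exact: leq_maxr.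
  by apply: mono; exact: leq_maxl.
by move=> x sx; exists n.+1 => //; rewrite iterS; right; exists s.
Qed.

Lemma hull_min E F : E `<=` F -> closed_under F -> hull E `<=` F.
Proof.
move=> EF cF x [n _]; elim: n x => [|n IH] x; first exact: EF.
rewrite iterS => -[/IH //|[s sE]]; apply: cF => y /sE; exact: IH.
Qed.

Lemma hull_closed_subset E : countable E -> closed_subsets (hull E).
Proof. by split; [exact: hull_countable|exact: hull_closed_under]. Qed.

Local Notation T := (set_type closed_subsets).

Lemma closed_subsets_omega_complete : omega_complete T.
Proof.
move=> A cA; pose U := \bigcup_(E in A) val E.
have cU : countable U.
  by apply: bigcup_countable => // E _; case: (set_mem (valP E)).
exists (exist _ (hull U) (mem_set (hull_closed_subset cU))); split.
  by move=> E AE; rewrite subfamily_leE => x Ex; apply: hull_sub; exists E.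
move=> G ubG; rewrite subfamily_leE; apply: hull_min.
  by move=> x [E /ubG]; rewrite subfamily_leE; exact.
by case: (set_mem (valP G)).
Qed.

Lemma closed_subsets_directed : directed_set [set: T].
Proof.
split.
  by exists (exist _ (hull set0) (mem_set (hull_closed_subset (countable0 J)))).
move=> E F _ _; have [|G [ubG _]] := @closed_subsets_omega_complete [set E; F].
  exact: finite_set_countable.
by exists G => //; apply/andP; split; apply: ubG; [left|right].
Qed.

(** A finite sequence from a directed union lies in one member, so the union is closed under [phi]
    without passing to its hull. This yields omega-continuity. *)
Lemma closed_subsets_lub (A : set T) g : isLub A g -> countable A ->
  directed_set A -> val g `<=` \bigcup_(E in A) val E.
Proof.
move=> [_ lub] cA [[E0 AE0] dirA]; pose U := \bigcup_(E in A) val E.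
have cU : closed_subsets U.
  split; first by apply: bigcup_countable => // E _; case: (set_mem (valP E)).
  move=> s sU.
  have [E AE sE] : exists2 E, A E & forall x, x \in s -> val E x.
    elim: s sU => [|x s IH] sU; first by exists E0.
    have [|E AE sE] := IH; first by move=> y ys; apply: sU; rewrite inE ys orbT.
    have [F AF Fx] : U x by apply: sU; rewrite inE eqxx.
    have [G AG /andP[]] := dirA _ _ AE AF.
    rewrite !subfamily_leE => EG FG.
    exists G => // y; rewrite inE => /predU1P[->|/sE/EG//]; exact: FG.
  move=> x sx; exists E => //.
  by have [_ cE] := set_mem (valP E); exact: cE sx.
have := lub (exist _ U (mem_set cU)); rewrite subfamily_leE; apply.
by move=> E AE; rewrite subfamily_leE => x Ex; exists E.
Qed.

Lemma closed_subsets_cover j : exists E : T, val E j.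
Proof.
have c1 : countable [set j] by exact/finite_set_countable/finite_set1.
by exists (exist _ (hull [set j]) (mem_set (hull_closed_subset c1))); exact: hull_sub.
Qed.

Context (X : compactumType) (M : J -> topologicalType).
Variable f : forall j, continuousType X (M j).
Hypothesis M_hausdorff : forall j, hausdorff_space (M j).
Hypothesis M_second_countable : forall j, @second_countable (M j).
Hypothesis f_separates : forall x y, (forall j, f j x = f j y) -> x = y.

Lemma closed_subset_mono (E F : T) : E <= F -> val E `<=` val F.
Proof. by rewrite subfamily_leE. Qed.

Definition closed_subset_spectrum : inverse_spectrum T :=
  fibre_spectrum f M_hausdorff closed_subset_mono.

Lemma closed_subset_spectrum_omega : omega_spectrum closed_subset_spectrum.
Proof.
split.
- move=> E; apply: fibre_compactum_second_countable => //.
  by case: (set_mem (valP E)).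
- exact: closed_subsets_omega_complete.
- exact/fibre_spectrum_omega_continuous/closed_subsets_lub.
Qed.

Lemma closed_subset_spectrum_limit :
  homeomorphic X (spectrum_lim closed_subset_spectrum).
Proof.
apply: fibre_spectrum_limit; first exact: closed_subsets_directed.
move=> x y xy; apply: f_separates => j; have [E Ej] := closed_subsets_cover j.
exact: xy Ej.
Qed.

(** The spectrum of quotients by closed countable index sets meets the other clauses of the
    definition; its bonding maps inherit skeletality from the projections of [X]. *)
Lemma skeletally_generated_family (R : realType) :
  (forall E, closed_subsets E -> skeletal (fibre_proj f E)) ->
  skeletally_generated R X.
Proof.
move=> sk; exists _, _, closed_subset_spectrum; split.
- exact: closed_subsets_directed.
- exact: closed_subset_spectrum_omega.
- move=> E; apply: second_countable_metrizable.
  by have [] := closed_subset_spectrum_omega.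
- move=> E F EF; split; first exact: fibre_spectrum_bonding_surjective.
  apply: fibre_spectrum_bonding_skeletal; apply: sk.
  exact: (set_mem (valP E)).
- exact: closed_subset_spectrum_limit.
Qed.

End closed_subsets.

(** * Supports in a monomorphic functor *)

Section subcompacta.
Implicit Types X Y Z : compactumType.

Lemma set_type_compact X (A : set X) : closed A -> compact [set: set_type A].
Proof.
move=> cA F PF _.
have FA : (val @ F) A.
  by apply: (@filterS _ F _ setT) filterT => x _; exact: (set_mem (valP x)).
have [p [Ap pF]] := closed_compact cA (fmap_proper_filter val PF) FA.
exists (exist _ p (mem_set Ap)); split=> // B C FB [_ [[W oW <-] /= Wp WC]].
have [||q [[y By <-] Wq]] := pF (val @` B) W.
- by apply: (@filterS _ F _ B) FB => y By; exists y.
- exact: open_nbhs_nbhs.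
- by exists y; split => //; exact: WC.
Qed.

Lemma set_val_continuous (T : topologicalType) (A : set T) :
  continuous (val : set_type A -> T).
Proof. exact: initial_continuous. Qed.

Lemma set_type_hausdorff X (A : set X) : hausdorff_space (set_type A).
Proof.
move=> p q pq; apply: val_inj; apply: (@compactum_hausdorff X) => U V nU nV.
have [x [Ux Vx]] := pq _ _ (@set_val_continuous _ A p _ nU)
                           (@set_val_continuous _ A q _ nV).
by exists (val x).
Qed.

Definition subcompactum X (A : set X) (cA : closed A) : compactumType :=
  HB.pack (set_type A) (Topological_isCompactum.Build (set_type A)
    (set_type_compact cA) (@set_type_hausdorff X A)).

Definition incl X (A : set X) (cA : closed A) : continuousType (subcompactum cA) X :=
  mkcts (@set_val_continuous X A).

Lemma incl_inj X (A : set X) (cA : closed A) : injective (incl cA).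
Proof. exact: val_inj. Qed.

Lemma inclP X (A : set X) (cA : closed A) x : A (incl cA x).
Proof. exact: (set_mem (valP x)). Qed.

Lemma incl_factor X Z (A : set X) (cA : closed A) (g : Z -> X) :
  continuous g -> (forall z, A (g z)) ->
  exists h : continuousType Z (subcompactum cA), forall z, incl cA (h z) = g z.
Proof.
move=> cg gA; pose h z : subcompactum cA := exist _ (g z) (mem_set (gA z)).
have ch : continuous h by apply: initial_topology_continuous.
by exists (mkcts ch).
Qed.

Lemma incl_surj X (A : set X) (cA : closed A) x : A x -> exists y, incl cA y = x.
Proof. by move=> Ax; exists (exist _ x (mem_set Ax)). Qed.

Lemma finite_closed X (A : set X) : finite_set A -> closed A.
Proof.
have /accessible_finite_set_closed : accessible_space X.
  exact/hausdorff_accessible/compactum_hausdorff.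
exact.
Qed.

Lemma finite_compactum_continuous X (T : topologicalType) (g : X -> T) :
  finite_set [set: X] -> continuous g.
Proof.
move=> fX; apply/continuous_closedP => A _; apply: finite_closed.
exact: sub_finite_set fX.
Qed.

Lemma finite_subcompactum X (A : set X) (cA : closed A) :
  finite_set A -> finite_set [set: subcompactum cA].
Proof.
move=> fA; rewrite -(eq_finite_set (inj_card_eq (f := incl cA) _)).
  by apply: sub_finite_set fA => _ [y _ <-]; exact: inclP.
by move=> y z _ _; exact: incl_inj.
Qed.

End subcompacta.

Section functor.
Context (F : comp_functor).
Implicit Types X Y Z : compactumType.

Lemma fmap_ext X Y (f g : continuousType X Y) : f =1 g -> fmap F f =1 fmap F g.
Proof. by move=> /continuousEP ->. Qed.

Lemma fmap_triangle X Y Z (f : continuousType X Y) (g : continuousType Y Z)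
    (h : continuousType X Z) :
  (forall x, h x = g (f x)) -> forall t, fmap F h t = fmap F g (fmap F f t).
Proof. by move=> hgf t; rewrite -fmap_comp; exact: fmap_ext. Qed.

Lemma fmap_homeomorphism X Y (f : continuousType X Y) :
  homeomorphism f -> homeomorphism (fmap F f).
Proof.
move=> [_ [g [cg fK gK]]]; split; first exact: cts_fun.
exists (fmap F (mkcts cg)); split; first exact: cts_fun.
  by move=> t; rewrite -(fmap_triangle (h := idfun)) ?fmap_id.
by move=> t; rewrite -(fmap_triangle (h := idfun)) ?fmap_id.
Qed.

(** For monomorphic [F] this is the copy of [F A] inside [F X]. *)
Definition supported X (A : set X) (cA : closed A) : set (F X) :=
  range (fmap F (incl cA)).

Lemma supported_closed X (A : set X) (cA : closed A) : closed (supported cA).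
Proof. by apply: continuous_image_closed; [exact: cts_fun|exact: closedT]. Qed.

Lemma supported_factor X Z (A : set X) (cA : closed A) (g : continuousType Z X) t :
  (forall z, A (g z)) -> supported cA (fmap F g t).
Proof.
move=> gA; have [|h hg] := incl_factor cA _ gA; first exact: cts_fun.
by exists (fmap F h t) => //; rewrite -(fmap_triangle (h := g)).
Qed.

Lemma supported_sub X (A B : set X) (cA : closed A) (cB : closed B) t :
  A `<=` B -> supported cA t -> supported cB t.
Proof.
move=> AB [u _ <-]; apply: supported_factor => z; apply: AB; exact: inclP.
Qed.

Hypothesis F_mono : monomorphic F.

Section intersection.
Hypothesis F_cont : functor_continuous F.
Context d (T : porderType d) (X : compactumType) (K : T -> set X).
Hypothesis dirT : directed_set [set: T].
Hypothesis K_closed : forall t, closed (K t).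
Hypothesis K_anti : forall s t, s <= t -> K t `<=` K s.

Lemma supported_bonding_ex s t (st : s <= t) :
  exists h : continuousType (subcompactum (@K_closed t)) (subcompactum (@K_closed s)),
    forall x, incl (@K_closed s) (h x) = incl (@K_closed t) x.
Proof.
apply: incl_factor; first exact: cts_fun.
by move=> z; apply: (K_anti st); exact: inclP.
Qed.

Let bond s t (st : s <= t) := projT1 (cid (supported_bonding_ex st)).

Let bondE s t (st : s <= t) x : incl (@K_closed s) (bond st x) = incl (@K_closed t) x.
Proof. by rewrite /bond; case: cid. Qed.

Program Definition intersection_spectrum : inverse_spectrum T :=
  @InverseSpectrum d T (fun t => subcompactum (@K_closed t)) bond _ _.
Next Obligation. by move=> t tt x; apply: incl_inj; exact: bondE. Qed.
Next Obligation.
by move=> r s t rs st rt x; apply: (@incl_inj _ _ (@K_closed r)); rewrite !bondE.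
Qed.

(** The preimages of [a] in [F] of the [K t] are unique because [F] is monomorphic, hence
    compatible; by continuity they come from [F] of the limit, which maps into the intersection of
    the [K t]. *)
Lemma supported_bigcap (L : set X) (cL : closed L) (a : F X) :
  (forall x, (forall t, K t x) -> L x) ->
  (forall t, supported (@K_closed t) a) -> supported cL a.
Proof.
move=> KL aK.
have [b bP] : exists b : forall t, F (subcompactum (@K_closed t)),
    forall t, fmap F (incl (@K_closed t)) (b t) = a.
  have H t : exists b, fmap F (incl (@K_closed t)) b = a by have [b _ <-] := aK t; exists b.
  by exists (fun t => projT1 (cid (H t))) => t; case: cid.
have bb : threads (S := map_spectrum F intersection_spectrum) b.
  move=> s t st; apply: (F_mono (@incl_inj _ _ (@K_closed s))).
  rewrite bP -(bP t); apply/esym/fmap_triangle => x; exact/esym/bondE.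
have [_ [g [_ _ gK]]] := @F_cont _ _ intersection_spectrum dirT.
pose c := g (exist _ b (mem_set bb)).
have cb t : fmap F (lim_proj (S := intersection_spectrum) t) c = b t.
  have := gK (exist _ b (mem_set bb)) => /(congr1 val).
  by move=> /(congr1 (fun x => x t)).
have [[t0 _] _] := dirT.
pose p := (incl (@K_closed t0) \o lim_proj (S := intersection_spectrum) t0).
rewrite -(bP t0) -cb -(fmap_triangle (h := p))//.
apply: supported_factor => z; apply: KL => t.
have [e _ /andP[te t0e]] := dirT.2 t t0 I I.
rewrite /p /= -(lim_proj_bonding t0e) (bondE t0e).
by rewrite -(bondE te); exact: inclP.
Qed.

End intersection.

Hypothesis F_preim : preserves_preimages F.

(** Preservation of preimages applied to the pullback [D] of [g] and [f]. Injectivity of [f] makes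
    the projection [h] injective, as the hypothesis on [F] demands. *)
Lemma preimage_lift X Y Z (f : continuousType Z Y) (g : continuousType X Y) a b :
  injective f -> fmap F g a = fmap F f b ->
  exists D : compactumType, exists h : continuousType D X,
    exists2 r : continuousType D Z, forall u, g (h u) = f (r u) &
    exists c : F D, fmap F h c = a /\ fmap F r c = b.
Proof.
move=> inj gafb.
pose P := [set p : X * Z | g p.1 = f p.2].
have cgX : continuous (fun p : X * Z => g p.1).
  by move=> p; apply: continuous_comp; [exact: fst_continuous|exact: cts_fun].
have cfZ : continuous (fun p : X * Z => f p.2).
  by move=> p; apply: continuous_comp; [exact: snd_continuous|exact: cts_fun].
have cP : closed P by apply: closed_equalizer => //; exact: compactum_hausdorff.
pose h : continuousType (subcompactum cP) X :=
  mkcts (@fst_continuous X Z) \o incl cP.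
pose r : continuousType (subcompactum cP) Z :=
  mkcts (@snd_continuous X Z) \o incl cP.
have hr u : g (h u) = f (r u) by exact: (inclP u).
have [||] := @F_preim _ _ _ _ h r g f inj.
- move=> u v huv; apply: (@incl_inj _ _ cP).
  have ruv : r u = r v by apply: inj; rewrite -!hr huv.
  by rewrite (surjective_pairing (incl cP u)) (surjective_pairing (incl cP v)); congr pair.
- split=> // z; apply/seteqP; split=> [_ [u /= <- <-]|x /= gx]; first exact: hr.
  have [u uE] := incl_surj cP (gx : P (x, z)).
  by exists u; rewrite /h /r /= uE.
move=> _ /(_ b) /seteqP[_ /(_ a gafb)[c cb ca]].
by exists (subcompactum cP), h; exists r => //; exists c.
Qed.

End functor.

(** * The functor applied to quotients by families of maps *)

Section functor_fibres.
Context (F : comp_functor).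
Hypothesis F_mono : monomorphic F.
Hypothesis F_cont : functor_continuous F.
Context (X : compactumType) (J : Type) (M : J -> topologicalType).
Variable f : forall j, continuousType X (M j).
Hypothesis M_hausdorff : forall j, hausdorff_space (M j).

Definition fibre_cts (A : set J) : continuousType X (fibre_compactum f M_hausdorff A) :=
  mkcts (@fibre_proj_continuous X J M f A).

Lemma fmap_fibre_cts_sub (A B : set J) x y : A `<=` B ->
  fmap F (fibre_cts B) x = fmap F (fibre_cts B) y ->
  fmap F (fibre_cts A) x = fmap F (fibre_cts A) y.
Proof.
move=> AB xy.
have AE : forall u, fibre_cts A u = fibre_bonding f M_hausdorff AB (fibre_cts B u).
  by move=> u; exact/esym/fibre_bondingE.
by rewrite !(fmap_triangle AE) xy.
Qed.

(** The quotient by [B] embeds into the limit of the quotients by the [K t], and [F] preserves both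
    the embedding and the limit. *)
Lemma fmap_fibre_cts_bigcup d (T : porderType d) (K : T -> set J) (B : set J) x y :
  directed_set [set: T] -> (forall s t, s <= t -> K s `<=` K t) ->
  (forall t, K t `<=` B) -> B `<=` \bigcup_t K t ->
  (forall t, fmap F (fibre_cts (K t)) x = fmap F (fibre_cts (K t)) y) ->
  fmap F (fibre_cts B) x = fmap F (fibre_cts B) y.
Proof.
move=> dirT K_mono KB BK xy.
pose S := fibre_spectrum f M_hausdorff K_mono.
pose h t := fibre_bonding f M_hausdorff (KB t).
have hP s t (st : s <= t) z : bonding S st (h t z) = h s z.
  have [u <-] := (surjective_mapP _).1 (@fibre_proj_surjective _ _ _ f B) z.
  by rewrite /h !fibre_bondingE.
have cL : continuous (lim_induced (S := S) hP).
  by apply: lim_induced_continuous => t; exact: cts_fun.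
pose L : continuousType (fibre_compactum f M_hausdorff B) (spectrum_lim S) := mkcts cL.
have injL : injective L.
  move=> z z'.
  have [u <-] := (surjective_mapP _).1 (@fibre_proj_surjective _ _ _ f B) z.
  have [u' <-] := (surjective_mapP _).1 (@fibre_proj_surjective _ _ _ f B) z'.
  move=> /(congr1 val) /= uu'; apply/fibre_proj_eq => j /BK[t _ Ktj].
  have := congr1 (fun v => v t) uu'.
  by rewrite /h !fibre_bondingE => /fibre_proj_eq; exact.
apply: (F_mono injL).
have [_ [g [_ cK _]]] := @F_cont _ _ S dirT.
apply: (can_inj cK); apply: val_inj; apply: functional_extensionality_dep => t /=.
have Lt z : fmap F (lim_proj (S := S) t) (fmap F L (fmap F (fibre_cts B) z)) =
    fmap F (fibre_cts (K t)) z.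
  rewrite -fmap_comp -fmap_comp; apply: fmap_ext => u /=; exact: fibre_bondingE.
exact: etrans (Lt x) (etrans (xy t) (esym (Lt y))).
Qed.

Lemma fmap_fibre_cts_separates d (T : porderType d) (K : T -> set J) x y :
  directed_set [set: T] -> (forall s t, s <= t -> K s `<=` K t) ->
  (forall j, exists t, K t j) -> (forall x y, (forall j, f j x = f j y) -> x = y) ->
  (forall t, fmap F (fibre_cts (K t)) x = fmap F (fibre_cts (K t)) y) -> x = y.
Proof.
move=> dirT K_mono covK sep xy.
have injT : injective (fibre_cts setT).
  by move=> u v /fibre_proj_eq uv; apply: sep => j; exact: uv.
apply: (F_mono injT); apply: fmap_fibre_cts_bigcup xy => // j _.
by have [t Ktj] := covK j; exists t.
Qed.

End functor_fibres.

HB.instance Definition _ := Topological_isCompactum.Build cantor_space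
  cantor_space_compact cantor_space_hausdorff.

(** * Density of finitely supported elements *)

Section finite_supports.
Context (F : comp_functor).
Hypothesis F_mono : monomorphic F.
Hypothesis F_epi : epimorphic F.
Hypothesis F_cont : functor_continuous F.

(** Remembering [n] coordinates gives a finite quotient, and for some [n] the fibre of [F] of the
    quotient map through [t] lies in [O]. A section of the quotient map yields a finitely supported
    element of that fibre. *)
Lemma cantor_finite_dense (O : set (F cantor_space)) t : open O -> O t ->
  exists D : compactumType, finite_set [set: D] /\
    exists (i : continuousType D cantor_space) (w : F D), O (fmap F i w).
Proof.
move=> oO Ot.
have cf (n : nat) : continuous (fun x : cantor_space => x n : bool).
  exact: (@proj_continuous nat (fun=> bool) n).
pose f n : continuousType cantor_space bool := mkcts (cf n).
have hb (n : nat) : hausdorff_space bool by exact: discrete_hausdorff.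
pose K (n : nat) : set nat := [set j | (j < n)%N].
have K_mono m n : m <= n -> K m `<=` K n.
  by move=> mn j /= jm; exact: leq_trans mn.
pose q n := fibre_cts f hb (K n).
have dirN : directed_set [set: nat].
  split; first by exists 0%N.
  by move=> m n _ _; exists (maxn m n) => //; rewrite !leEnat leq_maxl leq_maxr.
have [|||||||n nP] := @fibre_in_open (F cantor_space) nat
    (fun n => F (fibre_compactum f hb (K n))) (fun n => fmap F (q n)) t O.
- by exists 0%N.
- move=> m n; exists (maxn m n) => y z H.
  by split; move: H; apply: fmap_fibre_cts_sub; apply: K_mono;
    rewrite leEnat ?leq_maxl ?leq_maxr.
- by move=> n; exact: compactum_hausdorff.
- by move=> n; exact: cts_fun.
- move=> y z yz; apply: (fmap_fibre_cts_separates F_mono F_cont dirN K_mono) yz.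
    by move=> j; exists j.+1; rewrite /K /=.
  by move=> u v uv; apply/funext => j; exact: uv.
- exact: oO.
- exact: Ot.
have finD : finite_set [set: fibre_compactum f hb (K n)].
  pose c (y : fibre_compactum f hb (K n)) : n.-tuple bool :=
    [tuple (repr y : cantor_space) i | i < n].
  have injc : injective c.
    move=> y z cyz; rewrite -(reprK y) -(reprK z).
    apply/(fibre_proj_eq f (K n)) => j /= jn.
    by have := congr1 (fun v => tnth v (Ordinal jn)) cyz; rewrite !tnth_mktuple.
  rewrite -(eq_finite_set (inj_card_eq (f := c) _)); first exact: finite_finset.
  by move=> y z _ _; exact: injc.
have [s sK] := choice ((surjective_mapP _).1 (@fibre_proj_surjective _ _ _ f (K n))).
have cs : continuous (s : fibre_compactum f hb (K n) -> cantor_space).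
  exact: finite_compactum_continuous.
exists (fibre_compactum f hb (K n)); split=> //.
exists (mkcts cs), (fmap F (q n) t); apply: nP.
rewrite -(fmap_triangle (h := idfun)) ?fmap_id// => y; exact/esym/sK.
Qed.

(** A nonempty metrizable compactum is an image of the Cantor set, and [t] lifts along this
    surjection because [F] is epimorphic. *)
Lemma finite_dense (R : realType) (X : compactumType) (O : set (F X)) t :
  @second_countable X -> open O -> O t ->
  exists (A : set X) (fA : finite_set A) (w : F (subcompactum (finite_closed fA))),
    O (fmap F (incl (finite_closed fA)) w).
Proof.
move=> scX oO Ot.
suff [D [fD [i [w Ow]]]] : exists D : compactumType, finite_set [set: D] /\
    exists (i : continuousType D X) (w : F D), O (fmap F i w).
  have fA : finite_set (range i) by exact: finite_image.
  exists (range i), fA.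
  have [||h hi] := @incl_factor _ D (range i) (finite_closed fA) i.
  - exact: cts_fun.
  - by move=> z; exists z.
  by exists (fmap F h w); rewrite -(fmap_triangle (h := i)).
(* The empty compactum is not an image of the Cantor set, but it is finite itself. *)
have [[x0 _]|/nonemptyPn X0] := pselect ([set: X] !=set0); last first.
  exists X; split; first by rewrite X0; exact: finite_set0.
  by exists idfun, t; rewrite fmap_id.
have [M [e [ce [e' [ce' eK e'K]]]]] := second_countable_metrizable R scX.
pose P : pseudoPMetricType R :=
  HB.pack (Metric.sort M) (isPointed.Build (Metric.sort M) (e x0)).
have cP : compact [set: P].
  have -> : [set: P] = e @` [set: X].
    by apply/seteqP; split=> // y _; exists (e' y).
  apply: continuous_compact; first exact: continuous_subspaceT.
  exact: compactumT.
have [g cg] := @cantor_surj R P cP (@metric_hausdorff R M).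
have ceg : continuous (e' \o g : cantor_space -> X).
  by move=> x; apply: continuous_comp; [exact: cg|exact: ce'].
pose G : continuousType cantor_space X := mkcts ceg.
have sG : surjective_map G.
  apply/surjective_mapP => x; have [y _ gy] := @surj _ _ _ _ g (e x) I.
  by exists y; have := congr1 e' gy; rewrite eK.
have [u Gu] := (surjective_mapP _).1 (F_epi sG) t.
have [||D [fD [i [w Ow]]]] := @cantor_finite_dense (fmap F G @^-1` O) u.
- exact: (continuous_preimage_open (@cts_fun _ _ _)).
- by rewrite /= Gu.
exists D; split=> //; exists (G \o i), w.
by rewrite fmap_comp.
Qed.

End finite_supports.

(** * Neighbourhoods of a finitely supported element *)

Section shrinking.
Context (F : comp_functor).
Hypothesis F_mono : monomorphic F.
Hypothesis F_cont : functor_continuous F.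
Context (X : compactumType) (A : set X) (fA : finite_set A).

Lemma finite_separated_nbhs (V : X -> set X) : (forall x, A x -> nbhs x (V x)) ->
  exists N : X -> set X,
    (forall x, A x -> [/\ closed (N x), nbhs x (N x) & N x `<=` V x]) /\
    (forall x y, A x -> A y -> x <> y -> N x `&` N y = set0).
Proof.
move=> nV; have /finite_seqP[s As] := fA.
have [|x xs|N [NP Ndisj]] := @separated_nbhs X X s id V; first by [].
  by apply: nV; rewrite As.
exists N; split=> [x|x y]; rewrite As; first exact: NP.
by move=> xs ys; exact: Ndisj.
Qed.

Lemma closed_bigcup_finite (N : X -> set X) (B : set X) : B `<=` A ->
  (forall x, A x -> closed (N x)) -> closed (\bigcup_(x in B) N x).
Proof.
move=> BA cN; apply: closed_bigcup; first exact: sub_finite_set fA.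
by move=> x /BA/cN.
Qed.

Local Notation subA := (subcompactum (finite_closed fA)).
Local Notation inclA := (incl (finite_closed fA)).

(** Provides the control over lifts: elements are presented by a map [h] with a labelling [r] by
    points of [A], which is what the pullback in [preimage_lift] supplies. *)
Lemma finite_support_shrinking (w : F subA) (O : set (F X)) :
  open O -> O (fmap F inclA w) ->
  exists N : X -> set X,
    [/\ forall x, A x -> closed (N x) /\ nbhs x (N x),
        forall x y, A x -> A y -> x <> y -> N x `&` N y = set0
      & forall (D : compactumType) (h : continuousType D X)
          (r : continuousType D subA) (t : F D),
        (forall u, N (inclA (r u)) (h u)) -> fmap F r t = w -> O (fmap F h t)].
Proof.
move=> oO Ow.
have [|N0 [N0P N0disj]] := @finite_separated_nbhs (fun=> setT).
  by move=> x _; exact: filterT.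
pose K0 := \bigcup_(x in A) N0 x.
have cK0 : closed K0 by apply: closed_bigcup_finite => // x /N0P[].
have nK0 x : A x -> nbhs x K0.
  by move=> Ax; have [_ nN _] := N0P x Ax; apply: filterS nN => y Ny; exists x.
(* The sets [N0 x] are disjoint, so a point of [K0] lies in exactly one of them; [q] collapses it to
   the corresponding point of [A]. *)
have qx (u : subcompactum cK0) : exists y : subA, N0 (inclA y) (incl cK0 u).
  have [x Ax Nx] := inclP u; have [y yx] := incl_surj (finite_closed fA) Ax.
  by exists y; rewrite yx.
have [q qP] := choice qx.
have qU u y : N0 (inclA y) (incl cK0 u) -> q u = y.
  move=> Ny; apply: (@incl_inj _ _ (finite_closed fA)).
  apply: contrapT => /(N0disj _ _ (inclP _) (inclP _)) disj.
  suff : (N0 (inclA (q u)) `&` N0 (inclA y)) (incl cK0 u) by rewrite disj.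
  by [].
have cq : continuous q.
  apply/continuous_closedP => C _.
  have -> : q @^-1` C = incl cK0 @^-1` (\bigcup_(x in inclA @` C) N0 x).
    apply/seteqP; split=> [u Cu|u [_ [y Cy <-] /qU quy]] /=; last by rewrite quy.
    by exists (inclA (q u)) => //; exists (q u).
  apply: continuous_preimage_closed; first exact: cts_fun.
  apply: closed_bigcup_finite => [_ [y _ <-]|x /N0P[//]]; exact: inclP.
pose Q : continuousType (subcompactum cK0) subA := mkcts cq.
(* The order is reversed so that larger indices are smaller neighbourhoods, as a spectrum of
   inclusions requires. *)
pose nbh : set (set X)^d :=
  [set K : set X | closed K /\ forall x, A x -> nbhs x K].
pose T := set_type nbh.
have clT (K : T) : closed (val K : set X) by case: (set_mem (valP K)).
have nbT (K : T) x : A x -> nbhs x (val K : set X).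
  by case: (set_mem (valP K)) => _; exact.
have meetT (K L : set X) : nbh K -> nbh L -> nbh (K `&` L).
  move=> [cK nK] [cL nL]; split; first exact: closedI.
  by move=> x Ax; apply: filterI; [exact: nK|exact: nL].
have leT (K L : T) : (K <= L) = ((val L : set X) `<=` val K) :> Prop.
  by rewrite -subsetEset.
have dirT : directed_set [set: T].
  have nT : nbh setT by split=> // x _; exact: filterT.
  split; first by exists (exist _ setT (mem_set nT)).
  move=> K L _ _.
  exists (exist _ ((val K : set X) `&` val L)
    (mem_set (meetT _ _ (set_mem (valP K)) (set_mem (valP L))))) => //.
  by apply/andP; split; rewrite leT => x [].
(* [R K] collects the elements over [w] that are supported in [K] and yet fall outside [O]; one [K]
   without such elements suffices. *)
pose R (K : T) : set (F (subcompactum cK0)) :=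
  [set a | [/\ fmap F Q a = w, (~` O) (fmap F (incl cK0) a)
             & supported (F := F) (clT K) (fmap F (incl cK0) a)]].
(* An element lying over [w] and supported in all neighbourhoods of [A] is
   supported in [A], hence is [w] itself. *)
have [K RK] : exists K, R K = set0.
  apply: contrapT => RK.
  have [||||a aP] := @directed_closed_nonempty (F (subcompactum cK0)) T R.
  - by have [[K _] _] := dirT; exists K.
  - move=> K L; have [M _ /andP[]] := dirT.2 K L I I; rewrite !leT => KM LM.
    exists M => a [Qa nOa sa].
    by split; split=> //; apply: supported_sub sa.
  - move=> K; rewrite [X in closed X](_ : _ = [set a | fmap F Q a = w] `&`
        (fmap F (incl cK0) @^-1` (~` O) `&`
         fmap F (incl cK0) @^-1` supported (F := F) (clT K))).
      apply: closedI.
        by apply: closed_fibre; [exact: compactum_hausdorff|exact: cts_fun].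
      apply: closedI; (apply: continuous_preimage_closed; first exact: cts_fun).
        by rewrite closedC.
      exact: supported_closed.
    by apply/seteqP; split=> a; [case=> ? ? ?; split|case=> ? [? ?]; split].
  - by move=> K; apply: contrapT => /nonemptyPn RK0; apply: RK; exists K.
  have antiT (K L : T) : K <= L -> (val L : set X) `<=` val K by rewrite leT.
  have capT x : (forall K : T, (val K : set X) x) -> A x.
    move=> Kx; apply: contrapT => nAx.
    have [|N [NP _]] := @finite_separated_nbhs (fun=> ~` [set x]).
      move=> y Ay; apply: open_nbhs_nbhs; split; last by move=> /= yx; rewrite yx in Ay.
      by rewrite openC; exact: closed_singleton.
    have nbN : nbh (\bigcup_(y in A) N y).
      split; first by apply: closed_bigcup_finite => // y /NP[].
      by move=> y Ay; have [_ nN _] := NP y Ay; apply: filterS nN => z Nz; exists y.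
    have [y Ay Nyx] := Kx (exist _ (\bigcup_(y in A) N y) (mem_set nbN)).
    by have [_ _ /(_ _ Nyx) /=] := NP y Ay; exact.
  have aT K : supported (F := F) (clT K) (fmap F (incl cK0) a) by case: (aP K).
  have [w' _ w'a] := supported_bigcap F_mono F_cont dirT antiT (finite_closed fA) capT aT.
  have [[K _] _] := dirT; have [Qa nOa _] := aP K.
  have [||j jE] := @incl_factor _ subA K0 cK0 inclA.
  - exact: cts_fun.
  - by move=> y; apply: nbhs_singleton; apply: nK0; exact: inclP.
  have aj : a = fmap F j w'.
    by apply: (F_mono (@incl_inj _ _ cK0)); rewrite -w'a; apply: fmap_triangle.
  have w'w : w' = w.
    rewrite -Qa aj -(fmap_triangle (h := idfun)) ?fmap_id// => y.
    by apply/esym/qU; rewrite jE; apply: nbhs_singleton; have [] := N0P _ (inclP y).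
  by apply: nOa; rewrite -w'a w'w.
exists (fun x => N0 x `&` val K); split.
- move=> x Ax; have [cN nN _] := N0P x Ax; split.
    by apply: closedI => //; exact: clT.
  by apply: filterI => //; exact: nbT.
- move=> x y Ax Ay xy; apply/seteqP; split=> // z [[Nx _] [Ny _]].
  by rewrite -(N0disj x y Ax Ay xy).
move=> D h r t hN rt; apply: contrapT => nO.
have [||h0 h0E] := @incl_factor _ D K0 cK0 h.
- exact: cts_fun.
- by move=> u; have [N0u _] := hN u; exists (inclA (r u)) => //; exact: inclP.
suff : R K (fmap F h0 t) by rewrite RK.
have hE : fmap F (incl cK0) (fmap F h0 t) = fmap F h t.
  by rewrite (fmap_triangle (f := h0) (g := incl cK0)).
split.
- rewrite -rt; apply/esym/fmap_triangle => u; apply/esym/qU.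
  by rewrite h0E; have [] := hN u.
- by rewrite hE.
- by rewrite hE; apply: supported_factor => u; have [] := hN u.
Qed.

End shrinking.

(** * Functors and skeletal maps *)

(* A nonempty finite open set consists of isolated points. *)
Lemma distinct_representatives (Y : compactumType) (T : choiceType) (s : seq T)
    (V : T -> set Y) (y0 : T -> Y) :
  uniq s -> (forall t, t \in s -> open (V t) /\ V t !=set0) ->
  (forall t u y, t \in s -> u \in s -> t <> u -> open [set y] ->
     V t y -> V u y -> False) ->
  exists y : T -> Y, (forall t, t \in s -> V t (y t)) /\ {in s &, injective y}.
Proof.
elim: s => [|t s IH] /= us VP iso.
  by exists y0.
have /andP[ts {}us] := us.
have [||y [yV yinj]] := IH us.
- by move=> u us'; apply: VP; rewrite inE us' orbT.
- by move=> u v z us' vs; apply: iso; rewrite inE ?us' ?vs orbT.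
have [v Vv yv] : exists2 v, V t v & forall u, u \in s -> y u <> v.
  have [oV [v Vv]] := VP t (mem_head t s).
  apply: contrapT => nv.
  have Vy z : V t z -> exists2 u, u \in s & y u = z.
    move=> Vz; apply: contrapT => nu; apply: nv; exists z => // u us' uz.
    by apply: nu; exists u.
  have [u us' uv] := Vy v Vv.
  apply: (iso t u v); rewrite ?inE ?eqxx ?us' ?orbT//.
  - by move=> tu; rewrite tu us' in ts.
  - have -> : [set v] = V t `&` ~` (y @` [set u | u \in s /\ y u <> v]).
      apply/seteqP; split=> [_ -> /=|z [Vz nz] /=].
        by split=> // -[u' [_ +]]; exact.
      apply: contrapT => zv; apply: nz; have [u' us'' uz] := Vy z Vz.
      by exists u' => //; split=> //; rewrite uz.
    apply: openI => //; rewrite openC; apply: finite_closed; apply: finite_image.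
    apply: (@sub_finite_set _ _ [set u | u \in s]); first by move=> ? [].
    by apply/finite_seqP; exists s.
  - by rewrite -uv; exact: yV.
exists (fun u => if u == t then v else y u); split=> [u|u w].
  by rewrite inE; case: eqP => [-> //|_ /= /yV].
rewrite !inE; case: eqP => [-> _|_ /= us'].
  by case: eqP => [-> //|_ /= ws /esym/(yv _ ws)].
by case: eqP => [-> _ /(yv _ us')//|_ /= ws]; exact: yinj.
Qed.

Section skeletality.

Context (F : comp_functor).
Hypothesis F_mono : monomorphic F.
Hypothesis F_epi : epimorphic F.
Hypothesis F_cont : functor_continuous F.
Hypothesis F_preim : preserves_preimages F.
Variable R : realType.

(** The element [w] is carried to [F Y] along an injective [j] that sends each [x] of its support to
    a point interior to the image of [N x]; all elements near [fmap F j w] lift into [O]. *)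
Lemma fmap_skeletal (X Y : compactumType) (p : continuousType X Y) :
  @second_countable X -> surjective_map p -> skeletal p ->
  (forall y, open [set y] -> forall x x', p x = y -> p x' = y -> x = x') ->
  skeletal (fmap F p).
Proof.
move=> scX sp skp iso; apply/skeletalP; first exact: cts_fun.
move=> O t oO Ot.
have [A [fA [w Ow]]] := finite_dense F_mono F_epi F_cont R scX oO Ot.
have [N [NP Ndisj Nshrink]] := finite_support_shrinking F_mono F_cont oO Ow.
have /finite_seqP[s0 As0] := fA; pose s := undup s0.
have As x : x \in s <-> A x by rewrite mem_undup As0.
pose V x := (p @` N x)°.
have [||y [yV yinj]] := @distinct_representatives Y X s V p (undup_uniq s0).
- move=> x /As Ax; split; first exact: open_interior.
  have [cN nN] := NP x Ax; apply: contrapT => /nonemptyPn V0.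
  have /skeletalP -/(_ (@cts_fun _ _ _)) := skp.
  move=> /(_ _ x (@open_interior _ (N x)) nN); apply.
  apply: (nowhere_dense_sub (B := p @` N x)).
    by move=> _ [z /interior_subset Nz <-]; exists z.
  rewrite /nowhere_dense -(closure_id _).1//.
  by apply: continuous_image_closed => //; exact: cts_fun.
(* An isolated point of both [V x] and [V x'] has preimages in the disjoint sets [N x] and [N x'],
   which contradicts its one-point fibre. *)
- move=> x x' y /As Ax /As Ax' xx' oy /interior_subset[z Nz zy]
    /interior_subset[z' Nz' zy'].
  have zz' := iso y oy z z' zy zy'; rewrite -zz' in Nz'.
  by suff : (N x `&` N x') z by rewrite Ndisj.
have [|W [WP Wdisj]] := separated_nbhs (V := V) yinj.
  by move=> x xs; apply: open_nbhs_nbhs; split; [exact: open_interior|exact: yV].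
(* Over [W x] only the points of [N x] are kept, so that near the image of [w]
   every lift is controlled by the shrinking lemma. *)
pose T := \bigcap_(x in A) (~` (p @^-1` (W x)°) `|` N x).
have cT : closed T.
  apply: closed_bigI => x Ax; apply: closedU; last exact: (NP x Ax).1.
  rewrite closedC; apply: continuous_preimage_open; first exact: cts_fun.
  exact: open_interior.
pose p0 : continuousType (subcompactum cT) Y := p \o incl cT.
have sp0 : surjective_map p0.
  apply/surjective_mapP => v.
  (* A point in the interior of [W x] is lifted into [N x]; the sets [W x] being disjoint, [T]
     constrains the lift in no other way. *)
  have [z [Tz zv]] : exists z, T z /\ p z = v.
    have [[x [Ax Wx]]|nW] := pselect (exists x, A x /\ (W x)° v).
      have [_ _ WV] := WP x ((As x).2 Ax).
      have [z Nz zv] := interior_subset (WV _ (interior_subset Wx)).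
      exists z; split=> // x' Ax'.
      have [<-|/eqP xx'] := eqVneq x x'; first by right.
      left; rewrite /= zv => Wx'.
      have := Wdisj x x' ((As x).2 Ax) ((As x').2 Ax') xx'.
      move=> /seteqP[/(_ v)] /= + _; apply; split; exact: interior_subset.
    have [z zv] := (surjective_mapP _).1 sp v.
    by exists z; split=> // x Ax; left => /=; rewrite zv => Wx; apply: nW; exists x.
  have [z' z'z] := incl_surj cT Tz.
  by exists z'; rewrite /p0 /= z'z.
(* [U] consists of the elements all of whose lifts to [F] of [T] land in [O]; surjectivity of
   [fmap F p0] places it in the image of [O]. *)
pose U := ~` (fmap F p0 @` (fmap F (incl cT) @^-1` (~` O))).
have oU : open U.
  rewrite openC; apply: continuous_image_closed; first exact: cts_fun.
  by apply: continuous_preimage_closed; [exact: cts_fun|rewrite closedC].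
have cj : continuous ((y \o incl (finite_closed fA)) : subcompactum (finite_closed fA) -> Y).
  exact/finite_compactum_continuous/finite_subcompactum.
pose j : continuousType (subcompactum (finite_closed fA)) Y := mkcts cj.
have injj : injective j.
  move=> z z' /yinj zz'; apply: (@incl_inj _ _ (finite_closed fA)).
  by apply: zz'; apply/As; exact: inclP.
apply: (@open_not_nowhere_dense _ _ (fmap F j w)).
apply: (@filterS _ _ _ U).
  move=> v Uv; have [s' s'v] := (surjective_mapP _).1 (F_epi sp0) v.
  exists (fmap F (incl cT) s'); first by apply: contrapT => nO; apply: Uv; exists s'.
  by rewrite -s'v; apply/esym/fmap_triangle.
apply: open_nbhs_nbhs; split=> // -[s' nO s'w]; apply: nO.
(* A lift of [fmap F j w] comes from the part of [T] over the range of [j]. A point there over the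
   image of [x] lies over the interior of [W x], hence in [N x]. *)
have [D [h [r hr [c [<- cw]]]]] := preimage_lift F_preim injj s'w.
rewrite -(fmap_triangle (h := incl cT \o h))//.
apply: Nshrink cw => u.
have Th : T (incl cT (h u)) by exact: inclP.
have [nW|//] := Th _ (inclP (r u)).
case: nW => /=; rewrite (hr u : p (incl cT (h u)) = _).
by have [_ nW _] := WP (incl (finite_closed fA) (r u)) ((As _).2 (inclP _)).
Qed.

Lemma skeletal_of_fmap (X Y : compactumType) (p : continuousType X Y) :
  F1_neq_F2 F -> @second_countable Y -> surjective_map p ->
  skeletal (fmap F p) -> skeletal p.
Proof.
move=> F12 scY sp skp; apply/skeletalP; first exact: cts_fun.
move=> O x oO Ox ndO.
have [x' nOx'] : exists x', ~ O x'.
  apply: contrapT => /forallNP OT; move: ndO.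
  apply: (@open_not_nowhere_dense _ _ (p x)).
  apply: (@filterS _ _ _ setT); last exact: filterT.
  move=> y _; have [z <-] := (surjective_mapP _).1 sp y.
  by exists z => //; exact: contrapT.
have [K cK [nK KO]] := closed_nbhs (open_nbhs_nbhs (conj oO Ox)).
pose B := ~` K°.
have cB : closed B by rewrite closedC; exact: open_interior.
have [a na] : exists a, ~ range (fmap F incl12) a.
  apply: contrapT => /forallNP H; apply: F12; apply/seteqP; split=> // a _.
  exact: contrapT.
(* The point [1] goes to [x], outside [B]; so if [u] were supported in [B], the lift of [a] would
   see only the point [0], and [a] would come from [F] of [1]. *)
pose i0 (k : finite_space 2) : X := if (k : 'I_2) == ord0 then x' else x.
have ci : continuous i0.
  by apply: finite_compactum_continuous; exact: (@finite_finset 'I_2).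
pose i : continuousType (finite_space 2) X := mkcts ci.
pose u := fmap F i a.
have nsu : ~ supported (F := F) cB u.
  move=> [b _ bu].
  have [D [h [r hr [c [ca _]]]]] := preimage_lift F_preim (@incl_inj _ _ cB) (esym bu).
  apply: na; exists (fmap F (cst ord0 : continuousType D (finite_space 1)) c) => //.
  rewrite -ca; apply/esym/fmap_triangle => d.
  have Bhd : B (i (h d)) by rewrite hr; exact: inclP.
  have hd0 : (h d : 'I_2) == ord0.
    apply: contraT => hd; suff : B x by move=> /(_ nK).
    by move: Bhd; rewrite -[i (h d)]/(i0 (h d)) /i0 (negbTE hd).
  by apply: val_inj; rewrite /= (eqP hd0).
(* The neighbourhood is closed so that its image is closed, which later turns a point of the closure
   into the image of some [t]. *)
have [G0 cG0 [nG0 G0s]] : exists2 G0, closed G0 &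
    nbhs u G0 /\ G0 `<=` ~` supported (F := F) cB.
  apply: closed_nbhs; apply: open_nbhs_nbhs; split=> //.
  by rewrite openC; exact: supported_closed.
have /skeletalP -/(_ (@cts_fun _ _ _)) sk := skp.
have [v Vv] : (closure (fmap F p @` G0°))° !=set0.
  apply: contrapT => /nonemptyPn V0.
  exact: (sk G0° u (@open_interior _ _) nG0 V0).
have [A [fA [w Vw]]] :=
  finite_dense F_mono F_epi F_cont R scY (@open_interior _ _) Vv.
have [N [NP Ndisj Nshrink]] :=
  finite_support_shrinking F_mono F_cont (@open_interior _ _) Vw.
have ndK : nowhere_dense (p @` K).
  by apply: nowhere_dense_sub ndO => _ [z /KO Oz <-]; exists z.
(* No neighbourhood fits inside the nowhere dense image of [K], so the support of [w] can be moved
   off it while staying in the [N y]. *)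
have Hj (y : subcompactum (finite_closed fA)) :
    exists z, N (incl (finite_closed fA) y) z /\ ~ (p @` K) z.
  apply: contrapT => /forallNP H; move: ndK.
  apply: (@open_not_nowhere_dense _ _ (incl (finite_closed fA) y)).
  apply: (filterS _ (NP _ (inclP y)).2) => z Nz.
  by apply: contrapT => nz; apply: (H z).
have [j0 j0P] := choice Hj.
have cj : continuous j0.
  exact/finite_compactum_continuous/finite_subcompactum.
pose j : continuousType (subcompactum (finite_closed fA)) Y := mkcts cj.
have injj : injective j.
  move=> y y' yy'; apply: (@incl_inj _ _ (finite_closed fA)).
  apply: contrapT => /(Ndisj _ _ (inclP _) (inclP _))/seteqP[/(_ (j y)) + _].
  apply; split; first by have [] := j0P y.
  by rewrite yy'; have [] := j0P y'.
have Vj : (closure (fmap F p @` G0°))° (fmap F j w).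
  apply: (Nshrink _ _ idfun); last by rewrite fmap_id.
  by move=> y /=; have [] := j0P y.
have [t G0t tj] : (fmap F p @` G0) (fmap F j w).
  have cpG : closed (fmap F p @` G0).
    by apply: continuous_image_closed => //; exact: cts_fun.
  apply: cpG; apply: closureS (interior_subset Vj).
  by move=> _ [z /interior_subset G0z <-]; exists z.
(* Since [t] lies over [fmap F j w], it is supported on points mapped off the image of [K], hence in
   [B], contrary to the choice of [G0]. *)
have [D [h [r hr [c [ct _]]]]] := preimage_lift F_preim injj tj.
apply: (G0s t G0t); rewrite -ct; apply: supported_factor => d.
move=> /interior_subset Kd; have [_ +] := j0P (r d); apply.
by exists (h d) => //; rewrite hr.
Qed.

End skeletality.

(** * Skeletally generated compacta *)

Lemma homeomorphic_trans (X Y Z : topologicalType) :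
  homeomorphic X Y -> homeomorphic Y Z -> homeomorphic X Z.
Proof.
move=> [f [cf [f' [cf' fK f'K]]]] [g [cg [g' [cg' gK g'K]]]].
exists (g \o f); split.
  by move=> x; apply: continuous_comp; [exact: cf|exact: cg].
exists (f' \o g'); split; [|exact: can_comp|exact: can_comp].
by move=> x; apply: continuous_comp; [exact: cg'|exact: cf'].
Qed.

Lemma skeletally_generated_homeomorphic (R : realType) (X Y : compactumType) :
  homeomorphic X Y -> skeletally_generated R Y -> skeletally_generated R X.
Proof.
move=> XY [d [T [S [dirT omS mS bS YS]]]]; exists d, T, S; split=> //.
exact: homeomorphic_trans YS.
Qed.

(** By omega-continuity the stage at [g] is the limit of the stages in [A]. *)
Lemma lim_proj_lub d (T : porderType d) (S : inverse_spectrum T) (A : set T) g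
    (x y : spectrum_lim S) :
  omega_continuous S -> isLub A g -> countable A -> directed_set A ->
  (forall a, A a -> lim_proj a x = lim_proj a y) -> lim_proj g x = lim_proj g y.
Proof.
move=> omS lub cA dirA xy.
have [_ [h [_ hK _]]] := omS A g lub cA dirA.
apply: (can_inj hK); apply: val_inj; apply: functional_extensionality_dep => a /=.
by rewrite !lim_proj_bonding; apply: xy; exact: (set_mem (valP a)).
Qed.

(** * Images of omega-spectra under the functor *)

Section preservation.
Variables (R : realType) (F : comp_functor).
Hypothesis F_mono : monomorphic F.
Hypothesis F_epi : epimorphic F.
Hypothesis F_cont : functor_continuous F.
Hypothesis F_weight : weight_preserving F.
Hypothesis F_preim : preserves_preimages F.

(** The weight hypothesis speaks of infinite compacta; a finite [X] is embedded into the Cantor set,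
    and [F] preserves the embedding. *)
Lemma functor_second_countable (X : compactumType) :
  @second_countable X -> @second_countable (F X).
Proof.
have inf (Y : compactumType) : infinite_set [set: Y] -> @second_countable Y ->
    @second_countable (F Y).
  move=> iY [B cB bB]; have [C bC CB] := F_weight iY bB.
  by exists C => //; exact: sub_countable cB.
have [fX _|iX] := pselect (finite_set [set: X]); last exact: inf.
have [e einj] := countable_injP _ (finite_set_countable fX).
pose point_at (n m : nat) : bool := m == n.
have inj_at : injective (point_at : nat -> cantor_space).
  by move=> n m /(congr1 (fun v => v n)); rewrite /point_at eqxx => /esym/eqP.
have cg : continuous ((point_at \o e) : X -> cantor_space).
  exact: finite_compactum_continuous.
pose g : continuousType X cantor_space := mkcts cg.
have injg : injective g by move=> x y /inj_at; apply: einj; rewrite inE.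
have sc : @second_countable (F cantor_space).
  apply: inf.
    move=> fC; apply: infinite_nat.
    rewrite -(eq_finite_set (inj_card_eq (f := point_at : nat -> cantor_space) _)).
      exact: sub_finite_set fC.
    by move=> n m _ _; exact: inj_at.
  apply: (@second_countable_separating cantor_space nat setT (fun=> bool)
    (fun n x => x n)) => //.
  - by move=> n _; exact: discrete_hausdorff.
  - by move=> n _; exact: bool_second_countable.
  - by move=> n _; exact: (@proj_continuous nat (fun=> bool) n).
  - by move=> x y xy; apply/funext => n; exact: xy.
apply: (@second_countable_separating (F X) unit setT (fun=> F cantor_space)
  (fun _ => fmap F g)) => //.
- by move=> _ _; exact: compactum_hausdorff.
- by move=> _ _; exact: cts_fun.
- by move=> x y /(_ tt I)/(F_mono injg).
Qed.

Section map_spectrum.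
Context (X : compactumType) (J : choiceType) (phi : seq J -> set J).
Hypothesis phi_countable : forall s, countable (phi s).
Context (M : J -> topologicalType).
Variable f : forall j, continuousType X (M j).
Hypothesis M_hausdorff : forall j, hausdorff_space (M j).
Hypothesis M_second_countable : forall j, @second_countable (M j).
Hypothesis f_separates : forall x y, (forall j, f j x = f j y) -> x = y.

Local Notation S := (@closed_subset_spectrum J phi X M f M_hausdorff).

Lemma map_closed_subset_spectrum_omega : omega_spectrum (map_spectrum F S).
Proof.
have [sc om _] := closed_subset_spectrum_omega phi_countable f M_hausdorff M_second_countable.
split=> // [E|A g lub cA dirA]; first exact: functor_second_countable.
apply: lim_induced_homeomorphism.
- exact: directed_set_type.
- by move=> a; exact: cts_fun.
- by move=> a; apply: F_epi; exact: fibre_spectrum_bonding_surjective.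
have sq : surjective_map (fmap F (fibre_cts f M_hausdorff (val g))).
  by apply: F_epi; exact: fibre_proj_surjective.
(* Elements at stage [g] are lifted to [F X]; the members of [A] cover [val g], so agreement at all
   of them is agreement at [g]. *)
move=> u v; have [x <-] := (surjective_mapP _).1 sq u.
have [y <-] := (surjective_mapP _).1 sq v => xy.
apply: (fmap_fibre_cts_bigcup F_mono F_cont (K := fun E : set_type A => val (val E))).
- exact: directed_set_type.
- by move=> E E' EE'; exact: closed_subset_mono.
- move=> E; apply: closed_subset_mono; apply: lub.1; exact: (set_mem (valP E)).
- move=> j /(closed_subsets_lub lub cA dirA)[E AE Ej].
  by exists (exist _ E (mem_set AE)).
- move=> E; have H (z : F X) : fmap F (fibre_cts f M_hausdorff (val (val E))) z =
      fmap F (bonding S (ubound_val lub.1 E)) (fmap F (fibre_cts f M_hausdorff (val g)) z).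
    by apply: fmap_triangle => w; apply/esym/fibre_bondingE.
  by rewrite !H; exact: xy.
Qed.

(** The spectrum of [X] with [F] applied to it. The second hypothesis supplies the one-point fibres
    over isolated points that [fmap_skeletal] asks of bonding maps. *)
Lemma skeletally_generated_functor_family :
  (forall E, closed_subsets phi E -> skeletal (fibre_proj f E)) ->
  (forall E, closed_subsets phi E -> forall y : fibre_compactum f M_hausdorff E,
     open [set y] -> forall x x', fibre_proj f E x = y -> fibre_proj f E x' = y -> x = x') ->
  skeletally_generated R (F X).
Proof.
move=> sk iso; exists _, _, (map_spectrum F S); split.
- exact: closed_subsets_directed.
- exact: map_closed_subset_spectrum_omega.
- move=> E; apply: second_countable_metrizable.
  by have [] := map_closed_subset_spectrum_omega.
- move=> E E' EE'.
  have sb := fibre_spectrum_bonding_surjective f M_hausdorff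
    (@closed_subset_mono _ phi) EE'.
  split; first exact: F_epi.
  apply: (fmap_skeletal F_mono F_epi F_cont F_preim R) => //.
  + have [sc _ _] := closed_subset_spectrum_omega phi_countable f M_hausdorff
      M_second_countable.
    exact: sc.
  + by apply: fibre_spectrum_bonding_skeletal; apply: sk; exact: (set_mem (valP E)).
  + move=> y oy u u' uy u'y.
    have [x xu] := (surjective_mapP _).1 (@fibre_proj_surjective _ _ _ f (val E')) u.
    have [x' xu'] := (surjective_mapP _).1 (@fibre_proj_surjective _ _ _ f (val E')) u'.
    rewrite -xu -xu'; congr (fibre_proj f (val E') _).
    apply: (iso _ (set_mem (valP E)) y oy).
      by rewrite -uy -xu; apply/esym/fibre_bondingE.
    by rewrite -u'y -xu'; apply/esym/fibre_bondingE.
- have [h hh] := closed_subset_spectrum_limit phi_countable M_hausdorff f_separates.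
  apply: (@homeomorphic_trans _ (F (spectrum_lim S))).
    by exists (fmap F (mkcts hh.1)); exact: fmap_homeomorphism.
  by exists (lim_comparison (F := F) (S := S)); apply: F_cont; exact: closed_subsets_directed.
Qed.

End map_spectrum.
End preservation.

(** * Transfer of skeletal generation between [X] and [F X] *)

Section skeletal_generation.
Variables (R : realType) (F : comp_functor).
Hypothesis F_mono : monomorphic F.
Hypothesis F_epi : epimorphic F.
Hypothesis F_cont : functor_continuous F.
Hypothesis F_weight : weight_preserving F.
Hypothesis F_preim : preserves_preimages F.

(** The family consists of the limit projections. A closed [E] is directed, and the quotient by [E]
    has the same fibres as the skeletal projection to its supremum [g]. *)
Lemma skeletally_generated_functor (X : compactumType) :
  skeletally_generated R X -> skeletally_generated R (F X).
Proof.
move=> [d [T [S [dirT [scS omT omS] _ bS [e he]]]]].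
pose L : compactumType := spectrum_lim S.
apply: (@skeletally_generated_homeomorphic _ _ (F L)).
  by exists (fmap F (mkcts he.1)); exact: fmap_homeomorphism.
pose f a : continuousType L (S a) := lim_proj a.
have fB a b (ab : a <= b) x : bonding S ab (f b x) = f a x.
  exact: lim_proj_bonding.
have surjS a b (ab : a <= b) : surjective_map (bonding S ab) by have [] := bS a b ab.
have sf a : surjective_map (f a) by exact: lim_proj_surjective.
have hS a : hausdorff_space (S a) by exact: compactum_hausdorff.
have f_sep x y : (forall a, f a x = f a y) -> x = y by exact: lim_proj_separates.
have [ub ubP] := choice (fun s : seq T => upper_bound_seq s dirT).
(* If the fibre over [y] is nontrivial, [c] is an index at which two of its points differ; otherwise
   [a] serves as a default. *)
have split_ex a (y : S a) : exists c, forall x x', f a x = y -> f a x' = y ->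
    x <> x' -> exists z z', [/\ f a z = y, f a z' = y & f c z <> f c z'].
  have [[x [x' [xy x'y xx']]]|no] :=
      pselect (exists x x', [/\ f a x = y, f a x' = y & x <> x']).
    have [c fc] : exists c, f c x <> f c x'.
      by apply: contrapT => /forallNP H; apply: xx'; apply: f_sep => c; exact: contrapT.
    by exists c => _ _ _ _ _; exists x, x'.
  by exists a => x x' xy x'y xx'; case: no; exists x, x'.
(* Once [a] and [sep a y] are in E, no isolated point of the quotient by E lying
   over [y] can have a nontrivial fibre. *)
pose sep a (y : S a) := projT1 (cid (split_ex a y)).
(* The upper bounds make [E] directed; the other part stays countable because [S a] has countably
   many isolated points. *)
pose phi s : set T := [set ub s] `|`
  \bigcup_(a in [set a | a \in s]) (sep a @` [set y : S a | open [set y]]).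
have phi_countable s : countable (phi s).
  rewrite /phi -bigcup2E; apply: bigcup_countable => // -[|[|n]] _ //=.
  apply: bigcup_countable; first exact: countable_mem_seq.
  by move=> a _; apply: countable_image; exact: isolated_points_countable.
have dirE E : closed_subsets phi E -> directed_set E.
  move=> [_ cE]; split; first by exists (ub [::]); apply: (cE [::]) => //; left.
  move=> a b Ea Eb; exists (ub [:: a; b]).
    by apply: (cE [:: a; b]); [move=> c; rewrite !inE => /orP[]/eqP ->|left].
  by rewrite !ubP ?inE ?eqxx ?orbT.
apply: (skeletally_generated_functor_family R (M_hausdorff := hS) F_mono F_epi
  F_cont F_weight F_preim phi_countable scS f_sep).
- move=> E cE; have [g lub] := omT E cE.1.
  apply: (@skeletal_same_kernel L (S g) (fibre_compactum f hS E) (f g)).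
  + exact: cts_fun.
  + exact: sf.
  + exact: fibre_proj_continuous.
  + exact: fibre_proj_surjective.
  + move=> x y; split=> [xy|/fibre_proj_eq xy].
      apply/fibre_proj_eq => a Ea; have ag := lub.1 a Ea.
      by rewrite -!(fB _ _ ag) xy.
    exact: lim_proj_lub omS lub cE.1 (dirE E cE) xy.
  + by apply: lim_proj_skeletal => // a b ab; have [] := bS a b ab.
- move=> E cE y oy x x' xy x'y; apply: contrapT => xx'.
  have [h hP] := fibre_space_coordinates f E.
  (* By compactness one coordinate [a] in [E] isolates [y]. Then [f a x] is isolated in [S a], so
     [E] contains an index that differs on two points of a single fibre of the quotient by [E],
     which is absurd. *)
  have [|||||||a aP] := @fibre_in_open (fibre_compactum f hS E) {a | E a}
      (fun a => S (sval a)) (fun a => h (sval a)) y [set y].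
  + by have [[a Ea] _] := dirE E cE; exists (exist _ a Ea).
  + move=> [a Ea] [b Eb]; have [c Ec /andP[ac bc]] := (dirE E cE).2 a b Ea Eb.
    exists (exist _ c Ec) => u v /=.
    have [z <-] := (surjective_mapP _).1 (@fibre_proj_surjective _ _ _ f E) u.
    have [z' <-] := (surjective_mapP _).1 (@fibre_proj_surjective _ _ _ f E) v.
    rewrite !(hP _ Ea).2 !(hP _ Eb).2 !(hP _ Ec).2 => zz'.
    by rewrite -!(fB _ _ ac) -!(fB _ _ bc) zz'.
  + by move=> a; exact: hS.
  + by move=> [a Ea]; exact: (hP a Ea).1.
  + move=> u v uv.
    have [z zu] := (surjective_mapP _).1 (@fibre_proj_surjective _ _ _ f E) u.
    have [z' zv] := (surjective_mapP _).1 (@fibre_proj_surjective _ _ _ f E) v.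
    rewrite -zu -zv; apply/fibre_proj_eq => a Ea.
    by rewrite -!(hP a Ea).2 zu zv; exact: (uv (exist _ a Ea)).
  + exact: oy.
  + by [].
  case: a aP => a Ea /= aP.
  have fibreE z : f a z = f a x <-> fibre_proj f E z = y.
    split=> [zx|zy]; first by apply: aP; rewrite -xy !(hP a Ea).2.
    by have := zy; rewrite -xy => /fibre_proj_eq; exact.
  have oa : open [set f a x].
    rewrite -(setCK [set f a x]) openC.
    have -> : ~` [set f a x] = f a @` (~` (fibre_proj f E @^-1` [set y])).
      apply/seteqP; split=> [w wx|_ [z zy <-] /= /fibreE//].
      have [z zw] := (surjective_mapP _).1 (sf a) w.
      by exists z => // /fibreE zx; apply: wx; rewrite /= -zw.
    apply: continuous_image_closed; first exact: cts_fun.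
    rewrite closedC; apply: (continuous_preimage_open _ oy).
    exact: fibre_proj_continuous.
  have Esep : E (sep a (f a x)).
    apply: (cE.2 [:: a]); first by move=> b; rewrite inE => /eqP ->.
    by right; exists a; [rewrite /= inE|exists (f a x)].
  have x'x : f a x' = f a x by apply/fibreE.
  move: Esep; rewrite /sep; case: cid => c /= /(_ x x' erefl x'x xx').
  move=> [z [z' [/fibreE zx /fibreE z'x]]] + Ec; apply.
  by move: z'x; rewrite -zx => /esym/fibre_proj_eq; exact.
Qed.

(** The family consists of all real-valued maps on [X]. For closed [E], [F] of the quotient map has
    the same fibres as the projection of [F X] to some stage [g]; skeletality passes to it and, by
    [skeletal_of_fmap], to the quotient map. *)
Lemma skeletally_generated_of_functor (X : compactumType) : F1_neq_F2 F ->
  skeletally_generated R (F X) -> skeletally_generated R X.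
Proof.
move=> F12 [d [T [S [dirT [scS omT omS] _ bS [e he]]]]].
pose L : compactumType := spectrum_lim S.
pose p b : continuousType (F X) (S b) :=
  (lim_proj b : continuousType L (S b)) \o mkcts he.1.
have hS a : hausdorff_space (S a) by exact: compactum_hausdorff.
have surjS a b (ab : a <= b) : surjective_map (bonding S ab) by have [] := bS a b ab.
have inj_e : injective e by have [_ [e' [_ eK _]]] := he; exact: can_inj eK.
have p_sep x y : (forall b, p b x = p b y) -> x = y.
  by move=> xy; apply: inj_e; apply: lim_proj_separates.
have p_le a b x y : a <= b -> p b x = p b y -> p a x = p a y.
  by move=> ab xy; rewrite /p /= -!(lim_proj_bonding ab); congr (bonding S ab _).
pose J : choiceType := continuousType X R.
pose f (j : J) : continuousType X R := j.
have hR (j : J) : hausdorff_space R by exact: Rhausdorff.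
have scR (j : J) : @second_countable R by exact: real_second_countable.
have f_sep x y : (forall j, f j x = f j y) -> x = y by exact: real_maps_separate.
pose q E : continuousType X (fibre_compactum f hR E) := fibre_cts f hR E.
have scq E : countable E -> @second_countable (fibre_compactum f hR E).
  by move=> cE; apply: fibre_compactum_second_countable => // j _; exact: scR j.
(* [F] of the quotient by [s] is second countable, so countably many stages determine it;
   omega-completeness replaces them by one. *)
have b0_ex (s : seq J) : exists b, forall x y, p b x = p b y ->
    fmap F (q [set j | j \in s]) x = fmap F (q [set j | j \in s]) y.
  have cs : countable [set j | j \in s] by exact: countable_mem_seq.
  have [|A cA AP] := @countable_separation (F X)
      (F (fibre_compactum f hR [set j | j \in s])) T (fun b => S b)
      (fun b => p b) (fmap F (q [set j | j \in s])) hS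
      (fun b => cts_fun (s := p b)) p_sep
      (cts_fun (s := fmap F (q [set j | j \in s]))).
    exact/(functor_second_countable F_mono F_weight)/scq.
  have [b [ubb _]] := omT A cA.
  by exists b => x y xy; apply: AP => a Aa; apply: p_le xy; exact: ubb.
have [b0 b0P] := choice b0_ex.
pose lower (E : set J) := b0 @` [set s : seq J | forall j, j \in s -> E j].
have lower_countable E : countable E -> countable (lower E).
  by move=> cE; exact/countable_image/countable_seq.
(* [b0] need not be monotone; [b1] is, so that its values on the finite subsets
   of a set form a directed set. *)
have b1_ex (s : seq J) : exists b, isLub (lower [set j | j \in s]) b.
  by apply: omT; apply: lower_countable; exact: countable_mem_seq.
have [b1 b1P] := choice b1_ex.
have b1_mono s t : {subset s <= t} -> b1 s <= b1 t.
  move=> st; apply: (b1P s).2 => _ [u us <-]; apply: (b1P t).1.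
  by exists u => // j /us/st.
(* The quotients by finite sets of maps separate the points of [F X] after applying [F], so
   countably many of them determine the second countable stage [b]. *)
have A_ex b : exists2 A : set J, countable A &
    forall x y, fmap F (q A) x = fmap F (q A) y -> p b x = p b y.
  pose fin : set (set J) := [set E | finite_set E].
  have dirfin : directed_set [set: set_type fin].
    apply: union_closed_directed; first exact: finite_set0.
    by move=> E E' fE fE'; rewrite /fin /= finite_setU.
  have [] := @countable_separation (F X) (S b) (set_type fin)
    (fun E => F (fibre_compactum f hR (val E))) (fun E => fmap F (q (val E))) (p b).
  - by move=> E; exact: compactum_hausdorff.
  - by move=> E; exact: cts_fun.
  - move=> x y.
    apply: (fmap_fibre_cts_separates F_mono F_cont
      (K := fun E : set_type fin => val E)) => //.
      by move=> E E'; rewrite subfamily_leE.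
    by move=> j; exists (exist _ [set j] (mem_set (finite_set1 j : fin [set j]))).
  - exact: cts_fun.
  - exact: scS.
  move=> C cC CP; exists (\bigcup_(E in C) val E).
    apply: bigcup_countable => // E _; apply: finite_set_countable.
    exact: (set_mem (valP E)).
  move=> x y xy; apply: CP => E CE; apply: fmap_fibre_cts_sub xy => j Ej.
  by exists E.
pose phi s : set J := projT1 (cid2 (A_ex (b1 s))).
have phi_countable s : countable (phi s) by rewrite /phi; case: cid2.
have phiP s x y : fmap F (q (phi s)) x = fmap F (q (phi s)) y -> p (b1 s) x = p (b1 s) y.
  by rewrite /phi; case: cid2 => ? /= _; apply.
apply: (skeletally_generated_family phi_countable hR scR f_sep) => E [cE clE].
pose D := b1 @` [set s : seq J | forall j, j \in s -> E j].
have cD : countable D by exact/countable_image/countable_seq.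
have dirD : directed_set D.
  split; first by exists (b1 [::]); exists [::].
  move=> _ _ [s sE <-] [t tE <-]; exists (b1 (s ++ t)).
    by exists (s ++ t) => // j; rewrite mem_cat => /orP[/sE|/tE].
  by apply/andP; split; apply: b1_mono => j js; rewrite mem_cat js ?orbT.
have [g lub] := omT D cD.
apply: (skeletal_of_fmap F_mono F_epi F_cont F_preim R (p := q E)) => //.
- exact: scq.
- exact: fibre_proj_surjective.
apply: (@skeletal_same_kernel (F X) (S g) (F (fibre_compactum f hR E)) (p g)).
- exact: cts_fun.
- apply/surjective_mapP => y.
  have [z zy] := (surjective_mapP _).1 (lim_proj_surjective dirT surjS g) y.
  have [_ [e' [_ _ e'K]]] := he.
  by exists (e' z); rewrite /p /= -zy; congr (lim_proj g _); exact: e'K.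
- exact: cts_fun.
- by apply: F_epi; exact: fibre_proj_surjective.
(* Stage [g] lies above [b0 s] for all finite [s] in [E], so it determines [F] of the quotient by
   [E]. Conversely [E] contains each [phi s], so this quotient determines each stage [b1 s], hence
   [g]. *)
- move=> x y; split=> [xy|xy].
    pose fin : set (set J) := [set A | finite_set A /\ A `<=` E].
    apply: (fmap_fibre_cts_bigcup F_mono F_cont (K := fun A : set_type fin => val A)).
    + apply: union_closed_directed; first by split; [exact: finite_set0|].
      by move=> A A' [fA AE] [fA' A'E]; split; [rewrite finite_setU|rewrite subUset].
    + by move=> A A'; rewrite subfamily_leE.
    + by move=> A; have [_ AE] : fin (val A) by exact: (set_mem (valP A)).
    + move=> j Ej; have fj : fin [set j] by split; [exact: finite_set1|move=> _ ->].
      by exists (exist _ [set j] (mem_set fj)).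
    + move=> A; have [/finite_seqP[s As] AE] : fin (val A) by exact: (set_mem (valP A)).
      rewrite As; apply: b0P; apply: p_le xy.
      apply: (@le_trans _ _ (b1 s)).
        by apply: (b1P s).1; exists s.
      apply: lub.1; exists s => // j js; apply: AE; rewrite As; exact: js.
  apply: (lim_proj_lub omS lub cD dirD) => _ [s sE <-].
  apply: phiP; apply: fmap_fibre_cts_sub xy; exact: clE.
- apply: (@skeletal_comp _ _ _ e (lim_proj g)); first exact: skeletal_homeomorphism.
  by apply: lim_proj_skeletal => // a b ab; have [] := bS a b ab.
Qed.

End skeletal_generation.

Theorem theorem1p6 (R : realType) (F : comp_functor)
  (F_mecw : mecw_functor F) (F_preim : preserves_preimages F)
  (F12 : F1_neq_F2 F) (X : compactumType) :
  skeletally_generated R X <-> skeletally_generated R (F X).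
Proof.
have [F_mono F_epi F_cont F_weight] := F_mecw.
split; first exact: skeletally_generated_functor.
exact: skeletally_generated_of_functor.
Qed.
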